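(* Let $(\theta_0,i_0,s_* )$ be a minimizing triple with associated $\Lambda_1,\psi_1,\Lambda_2$. Assume that $\Lambda_1=0$ and that $\mathcal{L}_2$ is a non-positive operator. Then $$\Lambda_2\leq-c_1\|\psi_1\|_{L_2(\square)}^2,$$ where $c_1>0$ is the spectral gap constant, i.e. a constant independent of $\theta$ such that $$\operatorname{dist}\big(E_0(\theta),\sigma(\mathcal{H}_0(\theta))\setminus\{E_0(\theta)\}\big)\geq c_1\quad\text{for all }\theta\in\square^*.$$
   Context: Geometry. Let $d\geq d_1\geq 1$, let $e_1,\ldots,e_{d_1}$ be linearly independent vectors in $\mathbb{R}^d$ and $\Gamma:=\{z_1e_1+\ldots+z_{d_1}e_{d_1}:\ z_i\in\mathbb{Z}\}$. $\Pi\subseteq\mathbb{R}^d$ is an infinite domain with $C^{2m}$-smooth boundary that is invariant under shifts along $\Gamma$ ($x\in\Pi$, $k\in\Gamma$ imply $x-k\in\Pi$). $\square$ is a periodicity cell of $\Pi$, i.e. a minimal domain such that $\Pi$ is the interior of $\overline{\bigcup_{k\in\Gamma}\square_k}$, where $\square_k:=\{x:\ x-k\in\square\}$. Put $\gamma_\Pi:=\partial\square\cap\partial\Pi$, $\gamma_l:=\partial\square\setminus\partial\Pi$. Coefficients. Let $m\geq1$ be an integer and let $A_{\alpha\beta}=A_{\alpha\beta}(x)$ ($\alpha,\beta\in\mathbb{Z}_+^d$, $|\alpha|,|\beta|\leq m$) be $\square$-periodic functions on $\Pi$ with $A_{\alpha\beta}\in C^{|\alpha|}(\overline\Pi)$,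 $\overline{A_{\beta\alpha}}=A_{\alpha\beta}$, and $$\sum_{|\alpha|=|\beta|=m}A_{\alpha\beta}(x)\xi^{\alpha+\beta}\geq c_0|\xi|^{2m},\quad x\in\overline\Pi,\ \xi\in\mathbb{R}^d,$$ with a constant $c_0>0$. Perturbation. Let $\mathring{W}_2^{2m}(\square,\gamma_\Pi)$ be the subspace of $u\in W_2^{2m}(\square)$ with $u=0$, $\partial^ju/\partial\nu^j=0$ on $\gamma_\Pi$, $j=1,\ldots,m-1$ ($\nu$ the outward normal to $\partial\Pi$). For $t\in[-t_0,t_0]$, $t_0>0$, let $\mathcal{L}(t)=t\mathcal{L}_1+t^2\mathcal{L}_2+t^3\mathcal{L}_3(t)$, where $\mathcal{L}_1,\mathcal{L}_2,\mathcal{L}_3(t)$ are bounded operators from $\mathring{W}_2^{2m}(\square,\gamma_\Pi)$ into $L_2(\square)$, symmetric with respect to the $L_2(\square)$ scalar product, $\mathcal{L}_3(t)$ is bounded uniformly in $t$ and continuous in $t$. Only $\mathcal{L}_1$ and $\mathcal{L}_2$ enter the claim. The numbers $s_-,s_+$ are real with either $s_-<0<s_+$ or $0\leq s_-<s_+$. Floquet–Bloch data. Let $S$ be the linear span of $e_1,\ldots,e_{d_1}$, let $e_1^*,\ldots,e_{d_1}^*\in S$ be defined by $(e_i,e_j^* )_{\mathbb{R}^d}=2\pi\delta_{ij}$, and $\square^*:=\{\theta_1^*e_1^*+\ldots+\theta_{d_1}^*e_{d_1}^*:\ \theta_i^*\in[0,1)\}$. For $\theta\in\square^*$ let $$\mathcal{H}_0(\theta):=\sum_{|\alpha|,|\beta|\leq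 m}(-1)^{|\alpha|}(\partial+\mathrm{i}\theta)^\alpha A_{\alpha\beta}(\partial+\mathrm{i}\theta)^\beta,\qquad (\partial+\mathrm{i}\theta)^\alpha:=\prod_{j=1}^d\Big(\frac{\partial}{\partial x_j}+\mathrm{i}\theta_j\Big)^{\alpha_j},$$ be the (self-adjoint) operator in $L_2(\square)$ with the Dirichlet condition $u=0$, $\partial^ju/\partial\nu^j=0$ ($j=1,\ldots,m-1$) on $\gamma_\Pi$ and periodic boundary conditions on $\gamma_l$. It is assumed that $E_0(\theta):=\inf\sigma(\mathcal{H}_0(\theta))$ is a discrete eigenvalue for all $\theta\in\square^*$. The function $E_0$ attains its global minimum at some $\theta_0\in\square^*$; $\Lambda_0:=E_0(\theta_0)=\min_{\square^*}E_0$. Let $\psi_0^{(j)}$, $j=1,\ldots,n$, be the eigenfunctions of $\mathcal{H}_0(\theta_0)$ associated with $E_0(\theta_0)$ (a basis of the eigenspace), orthonormal in $L_2(\square)$ and chosen so that the matrix with entries $(\mathcal{L}_1e^{\mathrm{i}\theta_0x}\psi_0^{(i)},e^{\mathrm{i}\theta_0x}\psi_0^{(j)})_{L_2(\square)}$ is diagonal. Minimizing triple. A triple $(\theta_0,i_0,s_* )$ is minimizing if $\theta_0\in\square^*$ is a point at which $E_0$ attains its global minimum, i.e. $E_0(\theta_0)=\min_{\square^*}E_0$, and, among the $2n$ numbers $s_\pm(\mathcal{L}_1e^{\mathrm{i}\theta_0x}\psi_0^{(i)},e^{\mathrm{i}\theta_0x}\psi_0^{(i)})_{L_2(\square)}$,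 $i=1,\ldots,n$, the minimal value is attained at index $i=i_0$ and with $s_*\in\{s_-,s_+\}$. Given such a triple put $\psi_0:=\psi_0^{(i_0)}$ and $$\Lambda_1:=(\mathcal{L}_1e^{\mathrm{i}\theta_0x}\psi_0,e^{\mathrm{i}\theta_0x}\psi_0)_{L_2(\square)}.$$ Let $\psi_1$ be the unique solution, orthogonal in $L_2(\square)$ to all $\psi_0^{(j)}$, $j=1,\ldots,n$, of $$(\mathcal{H}_0(\theta_0)-\Lambda_0)\psi_1=-e^{-\mathrm{i}\theta_0x}\mathcal{L}_1e^{\mathrm{i}\theta_0x}\psi_0+\Lambda_1\psi_0,$$ and let $$\Lambda_2:=(\mathcal{L}_1e^{\mathrm{i}\theta_0x}\psi_1,e^{\mathrm{i}\theta_0x}\psi_0)_{L_2(\square)}+(\mathcal{L}_2e^{\mathrm{i}\theta_0x}\psi_0,e^{\mathrm{i}\theta_0x}\psi_0)_{L_2(\square)}.$$ ''$\mathcal{L}_2$ is non-positive'' means $(\mathcal{L}_2u,u)_{L_2(\square)}\leq0$ for all $u\in\mathring{W}_2^{2m}(\square,\gamma_\Pi)$. $\sigma(\cdot)$ denotes the spectrum. *)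

(* Defs.v *)
From HB Require Import structures.
From mathcomp Require Import all_boot all_order all_algebra.
From mathcomp Require Import complex.
From mathcomp Require Import all_classical all_reals all_analysis.

Set Implicit Arguments.
Unset Strict Implicit.
Unset Printing Implicit Defensive.

Import Order.TTheory GRing.Theory Num.Theory.
Import numFieldNormedType.Exports.

Local Open Scope classical_set_scope.
Local Open Scope ring_scope.

Section lebesgue_rV.
Context (R : realType) (d : nat).
Local Notation V := 'rV[R]_d.
Local Open Scope ereal_scope.

(* [None] is the empty box, so that finite coverings are sequences too. *)
Definition box (p : option (V * V)) : set V :=
  if p is Some (a, b)
  then [set x | forall i, (a ord0 i <= x ord0 i <= b ord0 i)%R] else set0.

Definition box_vol (p : option (V * V)) : \bar R :=
  if p is Some (a, b)
  then (\prod_i Num.max 0 (b ord0 i - a ord0 i))%:E else 0.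

Definition leb_outer (A : set V) : \bar R :=
  ereal_inf [set \sum_(k <oo) box_vol (F k) |
    F in [set F : nat -> option (V * V) | A `<=` \bigcup_k box (F k)]].

Lemma box_vol_ge0 p : 0 <= box_vol p.
Proof.
case: p => [[a b]|]//=; rewrite lee_fin; apply: prodr_ge0 => i _.
by rewrite le_max lexx.
Qed.

#[local] Hint Resolve box_vol_ge0 : core.

Lemma leb_outer_ge0 A : 0 <= leb_outer A.
Proof.
by apply: le_ereal_inf_tmp => _ [F _ <-]; apply: nneseries_ge0 => *; exact: box_vol_ge0.
Qed.

Lemma leb_outer0 : leb_outer set0 = 0.
Proof.
apply/eqP; rewrite eq_le leb_outer_ge0 andbT; apply: ereal_inf_lbound.
by exists (fun=> None); [exact: sub0set | rewrite eseries0].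
Qed.

Lemma le_leb_outer : {homo leb_outer : A B / A `<=` B >-> A <= B}.
Proof.
move=> A B AB; apply/ereal_inf_le_tmp => x [F FB <-].
by exists F => //; exact: subset_trans FB.
Qed.

Lemma leb_outer_sigma_subadditive : sigma_subadditive leb_outer.
Proof.
move=> A; have [[i ioo]|] := pselect (exists i, leb_outer (A i) = +oo).
  rewrite (eseries_pinfty _ _ ioo) ?leey// => n _.
  by rewrite -ltNye (lt_le_trans _ (leb_outer_ge0 _)).
rewrite -forallNE => Aoo.
suff add2e (e : {posnum R}) :
    leb_outer (\bigcup_n A n) <= \sum_(i <oo) leb_outer (A i) + e%:num%:E.
  by apply/lee_addgt0Pr => _/posnumP[].
rewrite (le_trans _ (epsilon_trick _ _ _))//; last first.
  by move=> n; exact: leb_outer_ge0.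
pose P n (B : nat -> option (V * V)) := A n `<=` \bigcup_k box (B k) /\
  \sum_(k <oo) box_vol (B k) <= leb_outer (A n) + (e%:num / (2 ^ n.+1)%:R)%:E.
have [G PG] : {G : nat -> nat -> option (V * V) & forall n, P n (G n)}.
  apply: (@choice _ _ P) => n; rewrite /P /leb_outer.
  set S := (X in ereal_inf X); move infS : (ereal_inf S) => iS.
  case: iS infS => [r Sr|Soo|Soo].
  - have en1 : (0 < e%:num / (2 ^ n.+1)%:R)%R by [].
    have /(lb_ereal_inf_adherent en1) : ereal_inf S \is a fin_num by rewrite Sr.
    move=> [x [B AnB muBx] xS].
    by exists B; split => //; rewrite muBx -Sr; exact/ltW.
  - by have := Aoo n; rewrite /leb_outer Soo.
  - suff : lbound S 0 by move/le_ereal_inf_tmp; rewrite Soo.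
    by move=> /= _ [B AnB <-]; apply: nneseries_ge0 => *; exact: box_vol_ge0.
have muG_ge0 x : 0 <= (box_vol \o uncurry G) x by exact: box_vol_ge0.
apply: (@le_trans _ _ (\esum_(i in setT) (box_vol \o uncurry G) i)).
  rewrite /leb_outer; apply: ereal_inf_lbound => /=.
  have /card_esym/ppcard_eqP[f] := card_nat2.
  exists (uncurry G \o f).
    move=> t [i _ Ait]; have [j _ Bijt] := (PG i).1 t Ait.
    by exists (f^-1%FUN (i, j)) => //=; rewrite invK ?inE.
  rewrite -(esum_pred_image (box_vol \o uncurry G) _ xpredT) ?[fun=> _]set_true//.
  by rewrite image_eq.
rewrite (_ : esum _ _ = \sum_(i <oo) \sum_(j <oo ) box_vol (G i j)); last first.
  pose J : nat -> set (nat * nat) := fun i => [set (i, j) | j in setT].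
  rewrite (_ : setT = \bigcup_k J k); last first.
    by rewrite predeqE => -[a b]; split => // _; exists a => //; exists b.
  rewrite esum_bigcupT /=; last 2 first.
    - apply/trivIsetP => i j _ _ ij.
      rewrite predeqE => -[n m] /=; split => //= -[] [_] _ [<-{n} _].
      by move=> [m' _] [] /esym/eqP; rewrite (negbTE ij).
    - by move=> /= [n m]; exact: box_vol_ge0.
  rewrite -(image_id [set: nat]) -fun_true esum_pred_image//; last first.
    by move=> n _; apply: esum_ge0 => i _; exact: box_vol_ge0.
  apply: eq_eseriesr => /= j _.
  rewrite -(esum_pred_image (box_vol \o uncurry G) (pair j) predT)//=; last first.
    by move=> ? ? _ _; exact: (@can_inj _ _ _ snd).
  by congr esum; rewrite predeqE => -[a b]; split; move=> [i _ <-]; exists i.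
apply: lee_lim.
- apply: is_cvg_nneseries => n *.
  by apply: nneseries_ge0 => m *; exact: (muG_ge0 (n, m)).
- by apply: is_cvg_nneseries => n *; apply: adde_ge0 => //; exact: leb_outer_ge0.
- by near=> n; apply: lee_sum => i _; exact: (PG i).2.
Unshelve. all: by end_near. Qed.

HB.instance Definition _ := isOuterMeasure.Build R V leb_outer
  leb_outer0 leb_outer_ge0 le_leb_outer leb_outer_sigma_subadditive.

(* R^d with the sigma-algebra of Lebesgue (= Caratheodory) measurable sets. *)
Definition lrV :=
  caratheodory_type (leb_outer : {outer_measure set V -> \bar R}).

Definition leb : {measure set lrV -> \bar R} :=
  ((leb_outer : {outer_measure set V -> \bar R}) : set lrV -> \bar R).

End lebesgue_rV.
Arguments lrV : clear implicits.
Arguments leb : clear implicits.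

Section functions.
Context (R : realType) (d : nat).
Local Notation C := R[i].
Local Notation V := 'rV[R]_d.
Local Notation F := (V -> C).
Local Notation mu := (leb R d).
Local Notation Re := (@complex.Re R).
Local Notation Im := (@complex.Im R).
Local Notation normc := (@ComplexField.Normc.normc R).
Implicit Types (Omega : set V) (f g u w : F) (x y theta : V).

Definition dotv x y : R := \sum_i x ord0 i * y ord0 i.

Definition cexpi theta : F :=
  fun x => (cos (dotv theta x) +i* sin (dotv theta x))%C.

Definition cmeasurable (D : set V) f : Prop :=
  measurable_fun (D : set (lrV R d)) (fun x => Re (f x) : R) /\
  measurable_fun (D : set (lrV R d)) (fun x => Im (f x) : R).

Definition cintegrable (D : set V) f : Prop :=
  mu.-integrable D (fun x => (Re (f x))%:E) /\
  mu.-integrable D (fun x => (Im (f x))%:E).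

Definition cintegral (D : set V) f : C :=
  (Rintegral mu D (fun x => Re (f x)) +i* Rintegral mu D (fun x => Im (f x)))%C.

Definition eq_ae (D : set V) f g : Prop := {ae mu, forall x, D x -> f x = g x}.

(* Elements of L_2(D) are represented by functions R^d -> C, of which only the
   restriction to D, up to equality almost everywhere, is relevant. *)
Definition L2space (D : set V) : set F := [set f | cmeasurable D f /\
  (\int[mu]_(x in (D : set (lrV R d))) (normc (f x) ^+ 2)%:E < +oo)%E].

Definition inner (D : set V) f g : C :=
  cintegral D (fun x => f x * conjc (g x)).

Definition L2norm (D : set V) f : R := Num.sqrt (Re (inner D f f)).

Definition L1loc Omega f : Prop :=
  forall K, compact K -> K `<=` Omega -> cintegrable K f.

Definition L2loc Omega f : Prop :=
  forall K, compact K -> K `<=` Omega -> L2space K f.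

Definition unitv (j : 'I_d) : V := delta_mx ord0 j.

Fixpoint rCk (k : nat) Omega (f : V -> R) : Prop :=
  {in Omega, continuous f} /\
  if k is k'.+1 then forall j,
    (forall x, Omega x -> derivable f x (unitv j)) /\
    rCk k' Omega (fun x => 'D_(unitv j) f x)
  else True.

Definition Ck k Omega f : Prop :=
  rCk k Omega (fun x => Re (f x)) /\ rCk k Omega (fun x => Im (f x)).

Definition cderive (v : V) f : F := fun x =>
  ('D_v (fun y => Re (f y) : R) x +i* 'D_v (fun y => Im (f y) : R) x)%C.

Definition mdeg (a : 'I_d -> nat) : nat := \sum_j a j.

(* (partial + i theta)^a, a composition of first order operators *)
Definition dtheta theta (a : 'I_d -> nat) f : F :=
  foldr (fun j g =>
    iter (a j) (fun h x => cderive (unitv j) h x + (0 +i* theta ord0 j)%C * h x) g)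
    f (enum 'I_d).

Definition partials (a : 'I_d -> nat) f : F := dtheta 0 a f.

(* C^k(closure Omega): all derivatives of order <= k on Omega extend
   continuously to the closure; the extension of f is f itself. *)
Definition Ck_closure k Omega f : Prop :=
  Ck k Omega f /\
  forall a, (mdeg a <= k)%N -> exists g,
    [/\ {within closure Omega, continuous (fun x => Re (g x) : R)},
        {within closure Omega, continuous (fun x => Im (g x) : R)},
        (forall x, Omega x -> g x = partials a f x)
      & (mdeg a = 0)%N -> forall x, closure Omega x -> g x = f x].

Definition test_fun Omega : set F := [set phi |
  (forall k, Ck k setT phi) /\
  exists K, [/\ compact K, K `<=` Omega & forall x, ~ K x -> phi x = 0]].

(* [v = P u] in the sense of distributions on Omega, for a differential operator
   P of order s with P^* = (-1)^s P: this is the case for (partial + i theta)^a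
   and for iterated real directional derivatives, as the pairing is
   sesquilinear. *)
Definition weakly Omega (P : F -> F) (s : nat) u (v : F) : Prop :=
  [/\ L1loc Omega u, L1loc Omega v &
    forall phi, test_fun Omega phi ->
      inner Omega v phi = (-1) ^+ s * inner Omega u (P phi)].

Definition weak_dtheta Omega theta a u (v : F) : Prop :=
  weakly Omega (dtheta theta a) (mdeg a) u v.

(* the weak (partial + i theta)^a u on Omega, when it exists (it is unique
   up to a null set) *)
Definition wdtheta Omega theta a u : F :=
  xget (fun=> 0) [set v | weak_dtheta Omega theta a u v].

Definition Wk2 k Omega : set F := [set u |
  L2space Omega u /\ forall a, (mdeg a <= k)%N ->
    exists2 v, L2space Omega v & weak_dtheta Omega 0 a u v].

Definition Wnorm k Omega u : R :=
  Num.sqrt (\sum_(a : {ffun 'I_d -> 'I_k.+1} | (mdeg (fun j => a j) <= k)%N)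
    L2norm Omega (wdtheta Omega 0 (fun j => a j) u) ^+ 2).

Definition bdry Omega : set V := closure Omega `\` Omega°.

Definition grad (rho : V -> R) x : V := \row_j 'D_(unitv j) rho x.

Definition defining_fun k Omega x (U : set V) (rho : V -> R) : Prop :=
  [/\ open U, U x, rCk k U rho, grad rho x <> 0 &
      forall y, U y -> (Omega y <-> rho y < 0)].

Definition smooth_boundary k Omega : Prop :=
  forall x, bdry Omega x -> exists U rho, defining_fun k Omega x U rho.

Definition outward_normal Omega x (nu : V) : Prop :=
  exists U rho, defining_fun 1 Omega x U rho /\
    nu = (Num.sqrt (dotv (grad rho x) (grad rho x)))^-1 *: grad rho x.

(* Radii are not required to be small: the s-dimensional Hausdorff content and
   the s-dimensional Hausdorff measure have the same null sets. *)
Definition hausdorff_null (s : nat) (A : set V) : Prop :=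
  forall eps : R, 0 < eps -> exists Bs : nat -> option (V * R),
    [/\ A `<=` \bigcup_k (if Bs k is Some (x, r) then ball x r else set0),
        (forall k x r, Bs k = Some (x, r) -> 0 < r)
      & (\sum_(k <oo) (if Bs k is Some (_, r) then (r ^+ s)%:E else 0) <= eps%:E)%E].

(* [w] has trace [c] at the boundary point [x] of Omega: the averages of
   |w - c| over ball(x,r) /\ Omega tend to zero. For Sobolev functions on a
   Lipschitz domain this is the value of the trace operator at x, for almost
   every x in the sense of surface measure. *)
Definition has_trace Omega w x (c : C) : Prop :=
  forall eps : R, 0 < eps -> \forall r \near 0^'+,
    (\int[mu]_(y in (ball x r `&` Omega : set (lrV R d)))
       (normc (w y - c))%:E <=
     eps%:E * mu (ball x r `&` Omega))%E.

(* u = 0 and d^j u / d nu^j = 0, j = 1, ..., m-1, on the part of the boundary of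
   Omega lying on the boundary of Pi, nu being the outward normal to bdry Pi. *)
Definition dirichlet m (Pi Omega : set V) u : Prop :=
  exists2 N, hausdorff_null d.-1 N &
    forall x, (bdry Omega `&` bdry Pi) x -> ~ N x ->
      exists2 nu, outward_normal Pi x nu &
        forall j, (j < m)%N -> exists2 w,
          weakly Omega (iter j (cderive nu)) j u w & has_trace Omega w x 0.

Definition W_dirichlet m (Pi cell : set V) : set F :=
  [set u | Wk2 (2 * m)%N cell u /\ dirichlet m Pi cell u].

Definition self_adjoint (D : set V) (dom : set F) (T : F -> F) : Prop :=
  [/\ (forall u, dom u -> L2space D u /\ L2space D (T u)),
      (forall f, L2space D f -> forall eps : R, 0 < eps ->
         exists2 u, dom u & L2norm D (fun x => f x - u x) < eps)
    & forall v g, L2space D v -> L2space D g ->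
        ((dom v /\ eq_ae D (T v) g) <->
         (forall u, dom u -> inner D (T u) v = inner D u g))].

Definition in_resolvent (D : set V) (dom : set F) (T : F -> F) (z : C) : Prop :=
  exists M : R, forall f, L2space D f -> exists u,
    [/\ dom u, eq_ae D (fun x => T u x - z * u x) f,
        L2norm D u <= M * L2norm D f
      & forall v, dom v -> eq_ae D (fun x => T v x - z * v x) f -> eq_ae D v u].

Definition spectrum (D : set V) (dom : set F) (T : F -> F) : set C :=
  [set z | ~ in_resolvent D dom T z].

Definition eigenfun (D : set V) (dom : set F) (T : F -> F) (z : C) : set F :=
  [set u | dom u /\ eq_ae D (T u) (fun x => z * u x)].

Definition eigenbasis (D : set V) (dom : set F) (T : F -> F) (z : C)
    n (psi : 'I_n -> F) : Prop :=
  [/\ (forall i, eigenfun D dom T z (psi i)),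
      (forall i j, inner D (psi i) (psi j) = (i == j)%:R)
    & forall u, eigenfun D dom T z u ->
        exists c : 'I_n -> C, eq_ae D u (fun x => \sum_i c i * psi i x)].

Definition discrete_eigenvalue (D : set V) (dom : set F) (T : F -> F) (z : C) :
    Prop :=
  [/\ (exists2 u, eigenfun D dom T z u & ~ eq_ae D u (fun=> 0)),
      (exists n (psi : 'I_n -> F), forall u, eigenfun D dom T z u ->
        exists c : 'I_n -> C, eq_ae D u (fun x => \sum_i c i * psi i x))
    & exists2 eps : R, 0 < eps & forall z', spectrum D dom T z' -> z' <> z ->
        eps%:C%C <= `|z' - z|].

Definition inf_spectrum (D : set V) (dom : set F) (T : F -> F) : \bar R :=
  ereal_inf [set s%:E | s in [set s : R | spectrum D dom T s%:C%C]].

Definition cdist (z : C) (S : set C) : \bar R :=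
  ereal_inf [set (normc (z - w))%:E | w in S].

End functions.

Section periodic.
Context (R : realType) (d d1 m : nat).
Local Notation C := R[i].
Local Notation V := 'rV[R]_d.
Local Notation F := (V -> C).
Local Notation midx := {ffun 'I_d -> 'I_m.+1}.
Implicit Types (e es : 'M[R]_(d1, d)) (Pi cell : set V) (theta : V).

Definition lattice e : set V :=
  [set k | exists z : 'rV[int]_d1, k = map_mx intr z *m e].

Definition shift (cell : set V) (k : V) : set V := [set x | cell (x - k)].

Definition is_domain (Omega : set V) : Prop :=
  [/\ open Omega, connected Omega & Omega !=set0].

Definition tiles e Pi cell : Prop :=
  Pi = (closure (\bigcup_(k in lattice e) shift cell k))°.

(* Minimality has to be understood up to sets which do not affect closures:
   removing one point from a cell (d >= 2) yields again a domain whose shifts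
   tile Pi. *)
Definition periodicity_cell e Pi cell : Prop :=
  [/\ is_domain cell, tiles e Pi cell &
      forall cell', is_domain cell' -> tiles e Pi cell' -> cell' `<=` cell ->
        closure cell' = closure cell].

Definition geometry e Pi cell : Prop :=
  [/\ row_free e, is_domain Pi /\ ~ bounded_set Pi, smooth_boundary (2 * m)%N Pi,
      (forall x k, Pi x -> lattice e k -> Pi (x - k))
    & periodicity_cell e Pi cell].

Definition dual_basis e es : Prop :=
  (es <= e)%MS /\ e *m es^T = (2 * pi)%:M.

Definition dual_cell es : set V :=
  [set theta | exists2 t : 'rV[R]_d1,
    (forall i, 0 <= t ord0 i < 1) & theta = t *m es].

Definition deg (a : midx) : nat := mdeg (fun j => a j).

(* A multi-index of length <= m has components in 0..m; of the family A only the
   members with deg a, deg b <= m are constrained and used. *)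
Definition coefficients e Pi (c0 : R) (A : midx -> midx -> F) : Prop :=
  [/\ (forall a b, (deg a <= m)%N -> (deg b <= m)%N ->
         Ck_closure (deg a) Pi (A a b)),
      (forall a b x k, (deg a <= m)%N -> (deg b <= m)%N ->
         closure Pi x -> lattice e k -> A a b (x - k) = A a b x),
      (forall a b x, (deg a <= m)%N -> (deg b <= m)%N ->
         closure Pi x -> conjc (A b a x) = A a b x)
    & forall x (xi : V), closure Pi x ->
        (c0 * dotv xi xi ^+ m)%:C%C <=
        \sum_(a : midx | deg a == m) \sum_(b : midx | deg b == m)
          A a b x * (\prod_j xi ord0 j ^+ (a j + b j))%:C%C].

(* Periodic boundary conditions on bdry cell \ bdry Pi: u is the restriction
   of a periodic function which is locally W_2^{2m} in Pi. *)
Definition periodic_bc e Pi cell (u : F) : Prop :=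
  exists2 U : F, (forall x k, lattice e k -> U (x - k) = U x) /\ eq_ae cell U u &
    forall a, (mdeg a <= 2 * m)%N ->
      exists2 v, L2loc Pi v & weak_dtheta Pi 0 a U v.

(* The outer derivatives are weak ones as well: for u in W_2^{2m} and A_{ab} in
   C^{|a|} all of them exist. *)
Definition H0 cell (A : midx -> midx -> F) theta (u : F) : F := fun x =>
  \sum_(a : midx | (deg a <= m)%N) \sum_(b : midx | (deg b <= m)%N)
    (-1) ^+ deg a *
    wdtheta cell theta (fun j => a j)
      (fun y => A a b y * wdtheta cell theta (fun j => b j) u y) x.

(* The last condition is automatic for bounded coefficients. *)
Definition dom_H0 e Pi cell (A : midx -> midx -> F) theta : set F :=
  [set u | [/\ W_dirichlet m Pi cell u, periodic_bc e Pi cell u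
             & L2space cell (H0 cell A theta u)]].

Definition symmetric_op Pi cell (L : F -> F) : Prop :=
  forall u v, W_dirichlet m Pi cell u -> W_dirichlet m Pi cell v ->
    inner cell (L u) v = inner cell u (L v).

Definition bounded_op Pi cell (M : R) (L : F -> F) : Prop :=
  [/\ (forall u, W_dirichlet m Pi cell u -> L2space cell (L u)),
      (forall (c : C) u v, W_dirichlet m Pi cell u -> W_dirichlet m Pi cell v ->
         eq_ae cell (L (fun x => c * u x + v x)) (fun x => c * L u x + L v x))
    & forall u, W_dirichlet m Pi cell u ->
        L2norm cell (L u) <= M * Wnorm (2 * m)%N cell u].

(* L(t) = t L1 + t^2 L2 + t^3 L3(t), L3 being uniformly bounded and continuous
   in the operator norm *)
Definition perturbation Pi cell (t0 : R) (L1 L2 : F -> F) (L3 L : R -> F -> F) :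
    Prop :=
  [/\ (exists M, bounded_op Pi cell M L1) /\ symmetric_op Pi cell L1,
      (exists M, bounded_op Pi cell M L2) /\ symmetric_op Pi cell L2,
      (exists M, forall t, -t0 <= t <= t0 -> bounded_op Pi cell M (L3 t)) /\
      (forall t, -t0 <= t <= t0 -> symmetric_op Pi cell (L3 t)),
      (forall t, -t0 <= t <= t0 -> forall eps : R, 0 < eps ->
         exists2 delta : R, 0 < delta & forall s, -t0 <= s <= t0 ->
           `|s - t| < delta -> forall u, W_dirichlet m Pi cell u ->
           L2norm cell (fun x => L3 s u x - L3 t u x) <=
             eps * Wnorm (2 * m)%N cell u)
    & forall t u, -t0 <= t <= t0 -> W_dirichlet m Pi cell u ->
        eq_ae cell (L t u) (fun x => t%:C%C * L1 u x + (t ^+ 2)%:C%C * L2 u x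
                                     + (t ^+ 3)%:C%C * L3 t u x)].

Definition nonpositive_op Pi cell (L : F -> F) : Prop :=
  forall u, W_dirichlet m Pi cell u -> inner cell (L u) u <= 0.

Definition sigma_H0 e Pi cell A theta : set C :=
  spectrum cell (dom_H0 e Pi cell A theta) (H0 cell A theta).

Definition E0 e Pi cell A theta : \bar R :=
  inf_spectrum cell (dom_H0 e Pi cell A theta) (H0 cell A theta).

Definition lowest_discrete e Pi cell A theta : Prop :=
  exists2 E : R, E0 e Pi cell A theta = E%:E &
    discrete_eigenvalue cell (dom_H0 e Pi cell A theta) (H0 cell A theta) E%:C%C.

Definition modulate theta (f : F) : F := fun x => cexpi theta x * f x.

Definition melem cell theta (L : F -> F) (f g : F) : C :=
  inner cell (L (modulate theta f)) (modulate theta g).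

Definition minimizing_triple e es Pi cell A (L1 : F -> F) (sm sp : R) theta0
    n (psi0 : 'I_n -> F) (i0 : 'I_n) (ss : R) : Prop :=
  [/\ dual_cell es theta0,
      (forall theta, dual_cell es theta ->
         (E0 e Pi cell A theta0 <= E0 e Pi cell A theta)%E),
      ss = sm \/ ss = sp
    & forall i s, s = sm \/ s = sp ->
        ss%:C%C * melem cell theta0 L1 (psi0 i0) (psi0 i0) <=
        s%:C%C * melem cell theta0 L1 (psi0 i) (psi0 i)].

Definition spectral_gap e Pi cell A theta : \bar R :=
  let E := (fine (E0 e Pi cell A theta))%:C%C in
  cdist E (sigma_H0 e Pi cell A theta `\ E).

End periodic.

(* Main.v *)
From HB Require Import structures.
Require Import Defs.
From mathcomp Require Import all_boot all_order all_algebra ssrAC.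
From mathcomp Require Import complex.
From mathcomp Require Import ring lra.
From mathcomp Require Import all_classical all_reals all_analysis.
From mathcomp Require Import measurable_realfun.

Set Implicit Arguments.
Unset Strict Implicit.
Unset Printing Implicit Defensive.

Import Order.TTheory GRing.Theory Num.Theory.
Import numFieldNormedType.Exports.

Local Open Scope classical_set_scope.
Local Open Scope ring_scope.

(** Let T be the fibre operator at theta_0, S = T - Lambda_0 and
    u_0 = exp(i theta_0 x) psi_0. As Lambda_1 = 0, the equation for psi_1
    reads exp(-i theta_0 x) L_1 u_0 = - S psi_1. By the symmetry of L_1 the
    first term of Lambda_2 is therefore - (S psi_1, psi_1), and the second
    one, (L_2 u_0, u_0), is non-positive. What is left is
    (S u, u) >= c_1 |u|^2 for every u in the domain that is orthogonal to
    the kernel of S.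

    This is [self_adjoint_spectral_gap]. It needs no spectral theorem, only
    that every real number below Lambda_0 + c_1 other than Lambda_0 lies in
    the resolvent set:
    - if the resolvent set contains a real interval of radius r about z,
      then |(T - z) u| >= r |u|, for otherwise the inverse of T - z, a
      bounded symmetric operator, would have plus or minus its norm in its
      approximate spectrum ([resolvent_ball_lower_bound]);
    - taking z = - r with r large shows that S >= 0, and z = c_1 / 2 shows
      that |S u|^2 >= c_1 (S u, u); the Cauchy-Schwarz inequality for the
      form of S turns this into S >= c_1 on the range of S
      ([range_coercive]);
    - the range of S is dense in the complement of the kernel, with
      convergence of the quadratic form: the iterates of t (S + t)^-1
      converge geometrically to the projection on the kernel
      ([orthogonal_kernel_approx]). Here completeness of L2 enters, in the
      form [L2space_complete].

    Symmetry of L_1 and non-positivity of L_2 are assumed on the Sobolev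
    space with Dirichlet conditions, so that u_0 and exp(i theta_0 x) psi_1
    have to lie in it ([W_dirichlet_modulate]). By duality this is a
    statement about test functions: conjugation by the plane wave replaces
    each derivative by a twisted one, a product of twisted derivatives
    expands into plain derivatives along subwords, and the plane wave has
    modulus one, so that L2 bounds and vanishing traces are preserved. The
    derivatives in the normal direction require that smooth functions have
    directional derivatives, linear in the direction.

    Integration over the cell makes sense since open sets are measurable for
    the Lebesgue outer measure ([open_measurable_lrV]). *)

(** * Self-adjoint relations with a spectral gap *)

Lemma quadratic_discriminant (R : realFieldType) (a b c : R) : 0 <= c ->
  (forall t, 0 <= a + t * b *+ 2 + t ^+ 2 * c) -> b ^+ 2 <= a * c.
Proof.
move=> c0 q; have := c0; rewrite le_eqVlt => /orP[/eqP c00|cp].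
  suff -> : b = 0 by rewrite -c00 mulr0 expr0n.
  apply/eqP; apply: contraT => b0.
  have := q (- (a + 1) / (b *+ 2)).
  have -> : a + - (a + 1) / (b *+ 2) * b *+ 2 + (- (a + 1) / (b *+ 2)) ^+ 2 * c
     = -1.
    by rewrite -c00; field; rewrite b0.
  by lra.
have := q (- b / c).
have -> : a + - b / c * b *+ 2 + (- b / c) ^+ 2 * c = (a * c - b ^+ 2) / c.
  by field; lra.
by rewrite pmulr_lge0 ?invr_gt0// subr_ge0.
Qed.

Lemma cvg0_scale (R : realType) a (f g : nat -> R) :
  (forall k, g k = a * f k) -> f @ \oo --> 0 -> g @ \oo --> 0.
Proof.
move=> gE f0; rewrite (_ : g = fun k => a * f k); last exact/funext.
by rewrite -[X in _ --> X](mulr0 a); exact: cvgMl_tmp.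
Qed.

Lemma cvg0_cst (R : realType) (a : R) : (fun _ : nat => a) @ \oo --> 0 -> a = 0.
Proof.
move=> a0; apply: (@cvg_unique _ (@norm_hausdorff _ R) _ _ a 0 _ a0).
exact: cvg_cst.
Qed.

Section selfadjoint.
Context (R : realType) (H : lmodType R) (ip : H -> H -> R).
Context (ipC : forall u v, ip u v = ip v u)
  (ipDl : forall u v w, ip (u + v) w = ip u w + ip v w)
  (ipZl : forall a u v, ip (a *: u) v = a * ip u v)
  (ip_ge0 : forall u, 0 <= ip u u).

Lemma ipDr u v w : ip u (v + w) = ip u v + ip u w.
Proof. by rewrite ipC ipDl ![ip _ u]ipC. Qed.

Lemma ipZr a u v : ip u (a *: v) = a * ip u v.
Proof. by rewrite ipC ipZl ipC. Qed.

Lemma ipNl u v : ip (- u) v = - ip u v.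
Proof. by rewrite -scaleN1r ipZl mulN1r. Qed.

Lemma ipNr u v : ip u (- v) = - ip u v.
Proof. by rewrite ipC ipNl ipC. Qed.

Lemma ip0r u : ip u 0 = 0.
Proof. by rewrite -(scale0r u) ipZr mul0r. Qed.

Definition ipE := (ipDl, ipDr, ipZl, ipZr, ipNl, ipNr).

Lemma ip_CauchySchwarz u v : ip u v ^+ 2 <= ip u u * ip v v.
Proof.
apply: quadratic_discriminant => // t; have := ip_ge0 (u + t *: v).
by rewrite !ipE (ipC v u); congr (_ <= _); ring.
Qed.

(** A self-adjoint operator enters through its graph: self-adjoint relations
    are linear and do not distinguish vectors at distance zero, so neither
    property has to be known for the operator beforehand. *)
Context (G : H -> H -> Prop).
Context (saG : forall v g, G v g <-> forall u f, G u f -> ip f v = ip u g).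

Lemma sa_sym u v f g : G u f -> G v g -> ip f v = ip u g.
Proof. by move=> Guf /saG; exact. Qed.

Lemma sa_lin a u v f g : G u f -> G v g -> G (a *: u + v) (a *: f + g).
Proof.
move=> Guf Gvg; apply/saG => w h Gwh; rewrite !ipE.
by rewrite (sa_sym Gwh Guf) (sa_sym Gwh Gvg).
Qed.

Lemma sa_scale a u f : G u f -> G (a *: u) (a *: f).
Proof.
move=> Guf; apply/saG => w h Gwh; rewrite !ipE.
by rewrite (sa_sym Gwh Guf).
Qed.

Lemma sa_sub u v f g : G u f -> G v g -> G (u - v) (f - g).
Proof.
move=> Guf Gvg; rewrite addrC -scaleN1r [f - g]addrC -(scaleN1r g).
exact: sa_lin.
Qed.

Definition resolvent_at (s : R) := exists M : R,
  (forall f, exists u, G u (f + s *: u)) /\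
  (forall u f, G u (f + s *: u) -> ip u u <= M * ip f f).

Lemma resolvent_bound s : resolvent_at s -> \forall M \near +oo,
  forall u f, G u (f + s *: u) -> ip u u <= M * ip f f.
Proof.
move=> [M [_ Ms]]; near=> K => u f /Ms /le_trans; apply.
by rewrite ler_wpM2r//; near: K; exact: nbhs_pinfty_ge.
Unshelve. all: by end_near. Qed.

(** Let [del ^+ 2] be the infimum of [|(G - z) u|^2 / |u|^2] and let [u]
    nearly attain it. If [w] is the solution of [(G - z) w = u], then
    [(G - z - del) (G - z + del) w] is small compared with [w], which is
    absurd when [z + del] and [z - del] are both in the resolvent set. *)
Lemma resolvent_ball_lower_bound (z r : R) : 0 < r ->
  (forall z', `|z' - z| < r -> resolvent_at z') ->
  forall u f, G u (f + z *: u) -> r ^+ 2 * ip u u <= ip f f.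
Proof.
move=> r0 rho u0 f0 Guf0; rewrite leNgt; apply/negP => u0r.
have u0p : 0 < ip u0 u0.
  rewrite lt_neqAle ip_ge0 andbT eq_sym; apply: contraTneq u0r => ->.
  by rewrite mulr0 -leNgt.
pose Q := [set q | exists u f, [/\ G u (f + z *: u), 0 < ip u u &
  q = ip f f / ip u u]].
have Q0 : lbound Q 0.
  by move=> _ [u [f [_ up ->]]]; rewrite divr_ge0.
have Qn : Q (ip f0 f0 / ip u0 u0) by exists u0, f0.
have hQ : has_inf Q by split; [exists (ip f0 f0 / ip u0 u0)|exists 0].
pose c := inf Q.
have c0 : 0 <= c by apply: lb_le_inf => //; exists (ip f0 f0 / ip u0 u0).
have cr : c < r ^+ 2.
  have /le_lt_trans -> // : c <= ip f0 f0 / ip u0 u0.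
    by apply: ge_inf => //; exists 0.
  by rewrite ltr_pdivrMr.
have cle u f : G u (f + z *: u) -> c * ip u u <= ip f f.
  move=> Guf; have := ip_ge0 u; rewrite le_eqVlt => /orP[/eqP <-|up].
    by rewrite mulr0.
  by rewrite -ler_pdivlMr//; apply: ge_inf; [exists 0|exists u, f].
pose del := Num.sqrt c.
have del2 : del ^+ 2 = c by rewrite sqr_sqrtr.
have del0 : 0 <= del by exact: sqrtr_ge0.
have delr : del < r.
  by rewrite -(ltr_pXn2r (_ : (0 < 2)%N))// ?nnegrE ?ltW// del2.
have rhop : resolvent_at (z + del).
  by apply: rho; rewrite addrC addKr ger0_norm.
have rhom : resolvent_at (z - del).
  by apply: rho; rewrite addrC addKr normrN ger0_norm.
have [K [K1 Kp Km]] : exists K, [/\ 1 <= K,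
    forall u f, G u (f + (z + del) *: u) -> ip u u <= K * ip f f &
    forall u f, G u (f + (z - del) *: u) -> ip u u <= K * ip f f].
  have : \forall K \near +oo%R, [/\ 1 <= K,
    forall u f, G u (f + (z + del) *: u) -> ip u u <= K * ip f f &
    forall u f, G u (f + (z - del) *: u) -> ip u u <= K * ip f f].
    near=> K; split; near: K; [exact: nbhs_pinfty_ge| |];
      exact: resolvent_bound.
  by move=> /filter_ex.
(* [eps] makes [K ^+ 2 * eps * (c + eps) < 1], the contradiction aimed at. *)
pose eps := (K ^+ 2 * (c + 1) + 1)^-1.
have K2c : 0 <= K ^+ 2 * (c + 1) by rewrite mulr_ge0 ?sqr_ge0// addr_ge0.
have eps0 : 0 < eps by rewrite invr_gt0 ltr_wpDl.
have eps1 : eps <= 1 by rewrite invf_le1 ?lerDr// ltr_wpDl.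
have epsK : eps * (K ^+ 2 * (c + 1)) < 1.
  by rewrite mulrC ltr_pdivrMr ?mul1r ?ltrDl// ltr_wpDl.
have [q [u [f [Guf up ->]]]] := inf_adherent eps0 hQ.
rewrite -/c ltr_pdivrMr// => fu.
have [_ [/(_ u)[w Gw] _]] : resolvent_at z.
  by apply: rho; rewrite subrr normr0.
have fw : ip f w = ip u u.
  have := sa_sym Guf Gw; rewrite !ipE => /addIr; exact.
have cw := cle _ _ Gw.
pose g := f - c *: w; pose y := u + del *: w.
have Gy : G y (g + (z + del) *: y).
  have /[!(addrC (del *: w))] := sa_lin del Gw Guf.
  rewrite -/y; congr (G _ _); rewrite /g /y -del2.
  rewrite !scalerDr !scalerDl !scalerA expr2 (mulrC z del).
  rewrite [RHS](AC (2*(2*2)) ((4*5)*(1*3)*(6*2))). by rewrite /= subrr addr0.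
have Gw' : G w (y + (z - del) *: w).
  by rewrite /y scalerBl -addrA [del *: w + _]addrCA subrr addr0.
have qw : ip w w <= K ^+ 2 * (eps * ip u u).
  apply: le_trans (Km _ _ Gw') _; rewrite expr2 -mulrA.
  apply: ler_wpM2l; first exact: le_trans K1.
  apply: le_trans (Kp _ _ Gy) _; apply: ler_wpM2l; first exact: le_trans K1.
  rewrite /g !ipE (ipC w f) fw; nra.
have pw : ip u u ^+ 2 <= ip f f * ip w w by rewrite -fw ip_CauchySchwarz.
have : ip u u ^+ 2 < ip u u ^+ 2.
  apply: le_lt_trans pw _.
  apply: (@le_lt_trans _ _ ((c + 1) * ip u u * (K ^+ 2 * (eps * ip u u)))).
    apply: ler_pM => //; apply: le_trans (ltW fu) _.
    by rewrite ler_wpM2r// lerD2l.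
  have -> : (c + 1) * ip u u * (K ^+ 2 * (eps * ip u u)) =
      eps * (K ^+ 2 * (c + 1)) * ip u u ^+ 2 by ring.
  by rewrite gtr_pMl// exprn_gt0.
by rewrite ltxx.
Unshelve. all: by end_near. Qed.

(** The lower bound at [- r], divided by [r], as [r] tends to infinity. *)
Lemma form_ge0 : (forall s, s < 0 -> resolvent_at s) ->
  forall u f, G u f -> 0 <= ip f u.
Proof.
move=> rho u f Guf; rewrite leNgt; apply/negP => fu0.
pose r := (ip f f + 1) / - (ip f u *+ 2).
have r0 : 0 < r by rewrite divr_gt0 ?ltr_wpDl// oppr_gt0 mulrn_wlt0.
have : r ^+ 2 * ip u u <= ip (f + r *: u) (f + r *: u).
  apply: (@resolvent_ball_lower_bound (- r)) => //.
    move=> z'; rewrite opprK => zr; apply: rho.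
    by move: zr; rewrite ltr_norml; lra.
  by rewrite scaleNr addrK.
rewrite !ipE (ipC u f).
have -> : ip f f + r * ip f u + (r * ip f u + r * (r * ip u u)) =
   r ^+ 2 * ip u u - 1.
  by rewrite /r; field; rewrite lt_eqF.
lra.
Qed.

(** The lower bound at the midpoint of the gap, squared and expanded. *)
Lemma form_gap c : 0 < c -> (forall s, 0 < s < c -> resolvent_at s) ->
  forall u f, G u f -> c * ip f u <= ip f f.
Proof.
move=> c0 rho u f Guf; pose z := c / 2.
have z0 : 0 < z by rewrite divr_gt0.
have : z ^+ 2 * ip u u <= ip (f - z *: u) (f - z *: u).
  apply: (@resolvent_ball_lower_bound z) => //; last by rewrite subrK.
  by move=> z'; rewrite ltr_norml /z => zr; apply: rho; lra.
rewrite !ipE (ipC u f) => h.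
have -> : c = z * 2 by rewrite /z divfK.
lra.
Qed.

Section gap.
Context (c : R) (c0 : 0 < c) (rhoN : forall s, s < 0 -> resolvent_at s)
  (rhoc : forall s, 0 < s < c -> resolvent_at s).

Lemma form_CauchySchwarz u v f g : G u f -> G v g ->
  ip f v ^+ 2 <= ip f u * ip g v.
Proof.
move=> Guf Gvg; apply: quadratic_discriminant; first exact: form_ge0 Gvg.
move=> t; have := form_ge0 rhoN (sa_lin t Gvg Guf).
rewrite !ipE; have := sa_sym Guf Gvg; rewrite (ipC u g); nra.
Qed.

(** With [S] the operator of graph [G] and [x = S y],
    [|x|^4 = (S y, x)^2 <= (S y, y) (S x, x)] and
    [c (S y, y) <= |S y|^2 = |x|^2]. *)
Lemma range_coercive y x g : G y x -> G x g -> c * ip x x <= ip g x.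
Proof.
move=> Gyx Gxg; have := form_CauchySchwarz Gyx Gxg.
have := form_gap c0 rhoc Gyx; have := form_ge0 rhoN Gxg.
have := ip_ge0 x; rewrite le_eqVlt => /orP[/eqP <-|xp]; first by rewrite mulr0.
move=> gx xy xx; rewrite -(ler_pM2l xp).
have : c * (ip x x ^+ 2) <= c * (ip x y * ip g x) by rewrite ler_pM2l.
nra.
Qed.

Lemma ip_le_sum u v : `|ip u v| *+ 2 <= ip u u + ip v v.
Proof.
have := ip_ge0 (u - v); have := ip_ge0 (u + v).
rewrite !ipE (ipC v u); case: (ger0P (ip u v)) => _; lra.
Qed.

Lemma cvg_ip_null (a b : nat -> H) :
  (fun k => ip (a k) (a k)) @ \oo --> 0 ->
  (fun k => ip (b k) (b k)) @ \oo --> 0 ->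
  (fun k => ip (a k) (b k)) @ \oo --> 0.
Proof.
move=> a0 b0; apply/norm_cvg0P.
apply: (@squeeze_cvgr _ _ _ _ (fun=> 0)
  (fun k => ip (a k) (a k) + ip (b k) (b k))).
- near=> k; rewrite normr_ge0/=; apply: le_trans (ip_le_sum _ _).
  by rewrite mulr2n lerDl.
- exact: cvg_cst.
- by rewrite -[X in _ --> X](addr0 0); exact: cvgD.
Unshelve. all: by end_near. Qed.

Lemma cvg_ip_null_cst u (a : nat -> H) :
  (fun k => ip (a k) (a k)) @ \oo --> 0 -> (fun k => ip u (a k)) @ \oo --> 0.
Proof.
move=> a0; suff : (fun k => ip u (a k) ^+ 2) @ \oo --> 0.
  move=> sq; have := cvg_comp _ _ sq (@sqrt_continuous R 0).
  rewrite sqrtr0 /comp; under eq_fun do rewrite sqrtr_sqr.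
  by move/norm_cvg0P.
apply: (@squeeze_cvgr _ _ _ _ (fun=> 0) (fun k => ip u u * ip (a k) (a k))).
- by near=> k; rewrite sqr_ge0/= ip_CauchySchwarz.
- exact: cvg_cst.
- exact: cvg0_scale a0.
Unshelve. all: by end_near. Qed.

Context (complete : forall (x : nat -> H) C,
  (forall k, ip (x k - x k.+1) (x k - x k.+1) <= C * 16%:R ^- k) ->
  exists v, (fun k => ip (x k - v) (x k - v)) @ \oo --> 0).

(** The iterates [x_k] of [t (S + t)^-1], where [S] is the operator with
    graph [G], converge to the projection of [u] on the kernel of [S]. The
    increments lie in the range of [S], where [S >= c]; the choice
    [t = c / 3] makes them decrease by the factor [t / (c + t) = 1 / 4]. *)
Lemma orthogonal_kernel_approx u f : G u f ->
  (forall k, G k 0 -> ip u k = 0) ->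
  exists x p : nat -> H, [/\
    (fun k => ip (x k) (x k)) @ \oo --> 0,
    (fun k => ip (p k) (p k)) @ \oo --> 0,
    forall k, G (x k.+1) (p k) & forall k, exists y, G y (u - x k)].
Proof.
move=> Guf uker; pose t := c / 3.
have t0 : 0 < t by rewrite divr_gt0.
have [_ [sol _]] : resolvent_at (- t) by apply: rhoN; rewrite oppr_lt0.
have [J GJ] : {J : H -> H & forall w, G (J w) (w - t *: J w)}.
  apply: (@choice _ _ (fun w v => G v (w - t *: v))) => w.
  by have [v] := sol w; rewrite scaleNr => Gv; exists v.
pose x k := iter k (fun w => J (t *: w)) u.
have [d dE] : exists d, forall k, d k = x k - x k.+1 by eexists.
have Gx k : G (x k.+1) (t *: d k) by rewrite dE scalerBr; exact: GJ.
have Gd k : G (t^-1 *: x k.+1) (d k).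
  have := sa_scale t^-1 (Gx k).
  by rewrite scalerA mulVf ?scale1r// gt_eqF.
have Gdd k : G (d k.+1) (t *: d k - t *: d k.+1).
  by rewrite {1}dE; exact: sa_sub.
have dle k : ip (d k.+1) (d k.+1) <= ip (d k) (d k) / 16%:R.
  have := range_coercive (Gd k.+1) (Gdd k); rewrite !ipE => h.
  have := ip_CauchySchwarz (d k) (d k.+1).
  have := ip_ge0 (d k.+1); have := ip_ge0 (d k).
  move: (ip (d k) (d k.+1)) (ip (d k) (d k)) (ip (d k.+1) (d k.+1)) h.
  move=> b a e h a0 e0 bae; have {}h : 4 * e <= b.
    rewrite -(ler_pM2l t0); have -> : t * (4 * e) = c * e + t * e.
      by rewrite /t; field.
    lra.
  move: e0; rewrite le_eqVlt => /orP[/eqP <-|e0]; first by rewrite divr_ge0.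
  rewrite ler_pdivlMr// -(ler_pM2r e0); nra.
have dk k : ip (d k) (d k) <= ip (d 0) (d 0) * 16%:R ^- k.
  elim: k => [|k ih]; first by rewrite expr0 invr1 mulr1.
  apply: le_trans (dle k) _.
  by rewrite exprS invfM mulrCA mulrC ler_wpM2l ?invr_ge0.
have d0 : (fun k => ip (d k) (d k)) @ \oo --> 0.
  apply: (@squeeze_cvgr _ _ _ _ (fun=> 0)
    (fun k => ip (d 0) (d 0) * 16%:R ^- k)).
  - by near=> k; rewrite ip_ge0 dk.
  - exact: cvg_cst.
  - apply: (@cvg0_scale _ (ip (d 0) (d 0)) (fun k => 16%:R^-1 ^+ k)) => [k|].
      by rewrite exprVn.
    by apply: cvg_expr; rewrite ger0_norm ?invr_ge0// invf_lt1// ltr1n.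
have [v xv] : exists v, (fun k => ip (x k - v) (x k - v)) @ \oo --> 0.
  by apply: (@complete _ (ip (d 0) (d 0))) => k; rewrite -dE; exact: dk.
have Gv : G v 0.
  apply/saG => w h Gwh; rewrite ip0r.
  have l1 : (fun k => ip h (x k.+1 - v)) @ \oo --> 0.
    apply: cvg_ip_null_cst.
    by rewrite (cvg_shiftS (fun k => ip (x k - v) (x k - v))).
  have l2 : (fun k => ip w (t *: d k)) @ \oo --> 0.
    apply: cvg0_scale (cvg_ip_null_cst w d0) => k; exact: ipZr.
  have l3 : (fun=> ip h v : R) @ \oo --> 0.
    rewrite -(subr0 0); apply: cvg_trans (cvgB l2 l1); apply: near_eq_cvg.
    near=> k; transitivity (ip w (t *: d k) - ip h (x k.+1 - v)) => //.
    by rewrite ipDr ipNr (sa_sym Gwh (Gx k)) opprB addrC subrK.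
  exact: cvg0_cst l3.
have xv0 k : ip (x k) v = 0.
  elim: k => [|k ih]; first exact: uker.
  have := sa_sym (Gx k) Gv; rewrite ip0r dE !ipE ih sub0r => /eqP.
  by rewrite mulf_eq0 gt_eqF// oppr_eq0 => /eqP.
have v0 : ip v v = 0.
  apply: cvg0_cst; apply: (@cvg0_scale _ (-1)) (cvg_ip_null_cst v xv) => k.
  by rewrite ipDr ipNr (ipC v) xv0 sub0r mulN1r opprK.
exists x, (fun k => t *: d k); split => //.
- apply: (@cvg0_scale _ 1) xv => k.
  by rewrite ipDl !ipDr !ipNl !ipNr (ipC v) !xv0 v0 !oppr0 !addr0 mul1r.
- by apply: (@cvg0_scale _ (t * t)) d0 => k; rewrite ipZl ipZr mulrA.
- elim=> [|k [y Gy]].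
    by exists (0 *: u); rewrite subrr -(scale0r f); exact: sa_scale.
  exists (1 *: y + t^-1 *: x k.+1).
  have -> : u - x k.+1 = 1 *: (u - x k) + d k by rewrite scale1r dE addrA subrK.
  exact: sa_lin.
Unshelve. all: by end_near. Qed.

(** Coercivity holds at [u - x k], which lies in the range, and passes to
    the limit since both [x k] and its image tend to zero. *)
Theorem spectral_gap_form u f : G u f ->
  (forall k, G k 0 -> ip u k = 0) -> c * ip u u <= ip f u.
Proof.
move=> Guf uker.
have [x [p [x0 p0 Gx Gy]]] := orthogonal_kernel_approx Guf uker.
have {x0}x0 : (fun k => ip (x k.+1) (x k.+1)) @ \oo --> 0.
  by rewrite (cvg_shiftS (fun k => ip (x k) (x k))).
have key k : c * (ip u u - ip u (x k.+1) *+ 2 + ip (x k.+1) (x k.+1)) <=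
  ip f u - ip f (x k.+1) - ip u (p k) + ip (p k) (x k.+1).
  have [y Gyu] := Gy k.+1.
  have := range_coercive Gyu (sa_sub Guf (Gx k)); rewrite !ipE.
  rewrite (ipC (x k.+1) u) (ipC (p k) u).
  by move=> h; apply: le_trans (le_trans _ h) _; rewrite le_eqVlt;
     apply/orP; left; apply/eqP; ring.
have lu := cvg_ip_null_cst u x0; have lf := cvg_ip_null_cst f x0.
have lp := cvg_ip_null_cst u p0; have lpx := cvg_ip_null p0 x0.
have L : (fun k => c * (ip u u - ip u (x k.+1) *+ 2 + ip (x k.+1) (x k.+1)))
    @ \oo --> c * (ip u u - 0 *+ 2 + 0).
  apply: cvgMr; apply: cvgD => //; apply: cvgB; first exact: cvg_cst.
  by rewrite !mulr2n; under eq_fun do rewrite mulr2n; exact: cvgD.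
have M : (fun k => ip f u - ip f (x k.+1) - ip u (p k) + ip (p k) (x k.+1))
    @ \oo --> ip f u - 0 - 0 + 0.
  by apply: cvgD => //; apply: cvgB => //; apply: cvgB => //; exact: cvg_cst.
have := ler_cvg_to L M; rewrite mul0rn !subr0 !addr0; apply.
by near=> k; exact: key.
Unshelve. all: by end_near. Qed.

End gap.
End selfadjoint.

(** * Completeness of real L2 spaces *)

Lemma cvg_geometric_increments (R : realType) (a : nat -> R) (M : R) :
  (forall k, `|a k - a k.+1| <= M * 2^-1 ^+ k) ->
  a @ \oo --> limn a /\ forall k, `|a k - limn a| <= 2 * M * 2^-1 ^+ k.
Proof.
move=> aM.
pose b k := a k + 2 * M * 2^-1 ^+ k; pose c k := a k - 2 * M * 2^-1 ^+ k.
have M0 : 0 <= M by have := aM 0%N; rewrite expr0 mulr1; apply: le_trans.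
have half k : 2^-1 ^+ k = 2 * 2^-1 ^+ k.+1 :> R by rewrite exprS mulVKf.
have bn : nonincreasing_seq b.
  apply/nonincreasing_seqP => k; rewrite /b; have := aM k.
  by rewrite half ler_norml; lra.
have cn : nondecreasing_seq c.
  apply/nondecreasing_seqP => k; rewrite /c; have := aM k.
  by rewrite half ler_norml; lra.
have e0 k : 0 <= M * 2^-1 ^+ k by rewrite mulr_ge0// exprn_ge0.
have bc : cvgn b.
  apply: nonincreasing_is_cvgn => //; exists (c 0%N) => _ [k _ <-].
  apply: le_trans (cn 0%N k (leq0n k)) _; rewrite /c /b; have := e0 k; lra.
have g0 : (fun k => 2 * M * 2^-1 ^+ k) @ \oo --> (0 : R).
  rewrite -[X in _ --> X](mulr0 (2 * M)); apply: cvgMl_tmp.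
  by apply: cvg_expr; rewrite ger0_norm// invf_lt1// ltr1n.
have al : a @ \oo --> limn b.
  have -> : a = b - (fun k => 2 * M * 2^-1 ^+ k).
    by apply/funext => k; rewrite fctE /b addrK.
  by rewrite -[X in _ --> X](subr0 (limn b)); exact: cvgB.
have cl : c @ \oo --> limn b.
  by rewrite -[X in _ --> X](subr0 (limn b)); exact: cvgB.
have al' : limn a = limn b by apply/cvg_lim.
rewrite al'; split => // k.
have h1 : limn b <= b k by exact: nonincreasing_cvgn_ge.
have h2 : c k <= limn b.
  rewrite -(cvg_lim (@norm_hausdorff _ R) cl).
  by apply: nondecreasing_cvgn_le => //; apply/cvg_ex; exists (limn b).
by rewrite ler_norml; move: h1 h2; rewrite /b /c; lra.
Qed.

Section square_integrable.
Context dd (T : measurableType dd) (R : realType)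
  (mu : {measure set T -> \bar R}) (D : set T) (mD : measurable D).
Implicit Types f g : T -> R.
Local Notation I := (Rintegral mu D).

Definition rintegrable f := mu.-integrable D (EFin \o f).

Definition sqint f := measurable_fun D f /\ rintegrable (fun x => f x ^+ 2).

Lemma rintegrable_meas f : rintegrable f -> measurable_fun D f.
Proof. by move=> /integrableP[/measurable_EFinP]. Qed.

Lemma rintegrable_le f g : measurable_fun D f ->
  (forall x, D x -> `|f x| <= g x) -> rintegrable g -> rintegrable f.
Proof.
move=> mf fg ig; apply: le_integrable ig => //; first exact/measurable_EFinP.
by move=> x Dx /=; rewrite lee_fin (le_trans (fg _ Dx))// ler_norm.
Qed.

Lemma rintegrableD f g : rintegrable f -> rintegrable g ->
  rintegrable (fun x => f x + g x).
Proof. exact: integrableD. Qed.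

Lemma rintegrableZ a f : rintegrable f -> rintegrable (fun x => a * f x).
Proof. exact: integrableZl. Qed.

Lemma rintegrableB f g : rintegrable f -> rintegrable g ->
  rintegrable (fun x => f x - g x).
Proof. exact: integrableB. Qed.

(** [2 |f g| <= f ^ 2 + g ^ 2]. *)
Lemma sqint_mul f g : sqint f -> sqint g -> rintegrable (fun x => f x * g x).
Proof.
move=> [mf if2] [mg ig2]; apply: rintegrable_le (rintegrableD if2 ig2).
  exact: measurable_funM.
move=> x _; rewrite ler_norml; have := sqr_ge0 (f x + g x).
have := sqr_ge0 (f x - g x); have := sqr_ge0 (f x); have := sqr_ge0 (g x).
nra.
Qed.

Lemma sqintZ a f : sqint f -> sqint (fun x => a * f x).
Proof.
move=> [mf if2]; split; first exact: measurable_funM.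
have := rintegrableZ (a ^+ 2) if2; apply: eq_integrable => // x _ /=.
by rewrite exprMn.
Qed.

Lemma sqintD f g : sqint f -> sqint g -> sqint (fun x => f x + g x).
Proof.
move=> sf sg; have [mf if2] := sf; have [mg ig2] := sg.
split; first exact: measurable_funD.
have := rintegrableD (rintegrableD if2 ig2) (rintegrableZ 2 (sqint_mul sf sg)).
by apply: eq_integrable => // x _ /=; congr EFin; ring.
Qed.

Lemma sqintB f g : sqint f -> sqint g -> sqint (fun x => f x - g x).
Proof.
move=> sf /(sqintZ (-1)) sg; have := sqintD sf sg.
by rewrite (_ : (fun x => _) = fun x => f x - g x)//; apply/funext => x; ring.
Qed.

Lemma sqint_bounded (b : T -> R) f : measurable_fun D b ->
  (forall x, D x -> `|b x| <= 1) -> sqint f -> sqint (fun x => b x * f x).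
Proof.
move=> mb b1 [mf if2]; split; first exact: measurable_funM.
apply: rintegrable_le if2.
  by apply: measurable_funX; exact: measurable_funM.
move=> x Dx; rewrite ger0_norm ?sqr_ge0// exprMn ler_piMl ?sqr_ge0//.
by rewrite -real_normK ?num_real// expr_le1 ?b1.
Qed.

Lemma RintegralE f : rintegrable f ->
  (I f)%:E = (\int[mu]_(x in D) (f x)%:E)%E.
Proof. by move=> fi; rewrite fineK//; exact: integrable_fin_num. Qed.

(** The weights [4 ^ k] turn the summability of the squared increments into
    a pointwise geometric bound off the set where the weighted series
    diverges; there the same bound holds trivially. *)
Lemma sqint_complete (f : nat -> T -> R) (C : R) : (forall k, sqint (f k)) ->
  (forall k, I (fun x => (f k x - f k.+1 x) ^+ 2) <= C * 16%:R ^- k) ->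
  exists2 g, sqint g & exists K, forall k,
    I (fun x => (f k x - g x) ^+ 2) <= K * 4^-1 ^+ k.
Proof.
move=> sf fC.
have C0 : 0 <= C.
  have := fC 0%N; rewrite expr0 invr1 mulr1; apply: le_trans.
  by apply: Rintegral_ge0 => x _; exact: sqr_ge0.
pose hk k x := (4 ^+ k * (f k x - f k.+1 x) ^+ 2)%:E.
have mhk k : measurable_fun D (hk k).
  apply/measurable_EFinP; apply: measurable_funM => //.
  by apply: measurable_funX; apply: measurable_funB; exact: (sf _).1.
have hk0 k x : (0 <= hk k x)%E.
  by rewrite lee_fin mulr_ge0 ?sqr_ge0 ?exprn_ge0.
pose h x := (\sum_(k <oo) hk k x)%E.
have mh : measurable_fun D h by apply: ge0_emeasurable_sum => *.
have h0 x : (0 <= h x)%E by apply: nneseries_ge0.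
pose H := (\int[mu]_(x in D) h x)%E.
have Hoo : (H < +oo)%E.
  rewrite /H integral_nneseries//.
  apply: (@le_lt_trans _ _ (\sum_(k <oo) ((2 * C) / (2 ^ (k + 1))%:R)%:E)%E).
    apply: lee_nneseries => [k _ _|k _]; first exact: integral_ge0.
    have sd := sqintB (sf k) (sf k.+1).
    rewrite -(RintegralE (rintegrableZ (4 ^+ k) sd.2)) lee_fin RintegralZl//.
      apply: le_trans (ler_wpM2l _ (fC k)) _; first by rewrite exprn_ge0.
      have -> : 16%:R = 4 * 4 :> R by rewrite -natrM.
      rewrite exprMn [leLHS](_ : _ = C * (4 ^+ k)^-1); last first.
        by field; rewrite expf_neq0.
      rewrite addn1 expnS natrM natrX [leRHS](_ : _ = C * (2 ^+ k)^-1).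
        rewrite ler_wpM2l// lef_pV2 ?posrE ?exprn_gt0//.
        by rewrite lerXn2r ?nnegrE// ler_nat.
      by field; rewrite expf_neq0.
    exact: sd.2.
  have := cvg_lim (@ereal_hausdorff R)
    (@cvg_geometric_eseries_half R (2 * C) 0).
  by rewrite /eseries/= => ->; exact: ltry.
pose E := D `&` [set x | h x \is a fin_num].
have mE : measurable E by exact: emeasurable_fin_num.
have hb k x : (hk k x <= h x)%E.
  have := @nneseries_lim_ge R (hk ^~ x) predT 0%N k.+1 (fun n _ _ => hk0 n x).
  apply: le_trans; rewrite big_nat_recr//=.
  by rewrite leeDr// sume_ge0.
have cE x : E x -> (f ^~ x) @ \oo --> limn (f ^~ x) /\
    forall k, (f k x - limn (f ^~ x)) ^+ 2 <= 4 * 4^-1 ^+ k * fine (h x).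
  move=> [Dx hx]; pose M := Num.sqrt (fine (h x)).
  have M2 : M ^+ 2 = fine (h x) by rewrite sqr_sqrtr// fine_ge0.
  have M0 : 0 <= M by exact: sqrtr_ge0.
  have e4 k : (2^-1 ^+ k) ^+ 2 = 4^-1 ^+ k :> R.
    by rewrite -exprM mulnC exprM; congr (_ ^+ k); field.
  have inc k : `|f k x - f k.+1 x| <= M * 2^-1 ^+ k.
    rewrite -(ler_pXn2r (_ : (0 < 2)%N))// ?nnegrE ?mulr_ge0 ?exprn_ge0//.
    rewrite real_normK ?num_real// exprMn M2 e4 exprVn.
    rewrite ler_pdivlMr ?exprn_gt0// mulrC.
    by rewrite -lee_fin fineK//; exact: hb.
  have [? fM] := cvg_geometric_increments inc; split=> // k.
  rewrite -M2 -e4 [leRHS](_ : _ = (2 * M * 2^-1 ^+ k) ^+ 2); last by ring.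
  rewrite -real_normK ?num_real// ler_pXn2r// nnegrE//.
  by rewrite !mulr_ge0 ?exprn_ge0.
pose g := (fun x => limn (f ^~ x)) \_ E.
have ED : E `<=` D by move=> x [].
have mg : measurable_fun D g.
  apply/measurable_restrict => //; rewrite setIidr//.
  apply: (@measurable_fun_cvg _ _ _ _ f).
    by move=> k; apply: measurable_funS (sf k).1.
  by move=> x /cE[].
have mfg k : measurable_fun D (fun x => (f k x - g x) ^+ 2).
  by apply: measurable_funX; apply: measurable_funB => //; exact: (sf k).1.
have key k : (\int[mu]_(x in D) ((f k x - g x) ^+ 2)%:E <=
              (4 * 4^-1 ^+ k)%:E * H)%E.
  have c4 : 0 < 4 * 4^-1 ^+ k :> R by rewrite mulr_gt0 ?exprn_gt0.
  have c4e : (0 <= (4 * 4^-1 ^+ k)%:E :> \bar R)%E by rewrite lee_fin ltW.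
  rewrite -ge0_integralZl//.
  apply: ge0_le_integral => //.
  - by move=> x _; rewrite lee_fin sqr_ge0.
  - exact/measurable_EFinP.
  - exact: measurable_funeM.
  - move=> x Dx; have [hx|hx] := boolP (h x \is a fin_num).
      have Ex : E x by [].
      by rewrite /g patchE mem_set// -(fineK hx) -EFinM lee_fin (cE x Ex).2.
    have -> : h x = +oo%E.
      by move: hx (h0 x); case: (h x).
    by rewrite gt0_muley ?lte_fin// leey.
have Hfin : H \is a fin_num by rewrite ge0_fin_numE// integral_ge0.
have sfg k : sqint (fun x => f k x - g x).
  split; first by apply: measurable_funB => //; exact: (sf k).1.
  apply/integrableP; split; first exact/measurable_EFinP.
  under eq_integral => x _ do rewrite gee0_abs ?lee_fin ?sqr_ge0//.
  by apply: le_lt_trans (key k) _; rewrite -(fineK Hfin) -EFinM ltry.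
exists g.
  have := sqintB (sf 0%N) (sfg 0%N).
  by under [X in sqint X]eq_fun do rewrite subKr.
exists (4 * fine H) => k; rewrite -lee_fin RintegralE; last exact: (sfg k).2.
by apply: le_trans (key k) _; rewrite -(fineK Hfin) -EFinM lee_fin mulrAC.
Qed.

End square_integrable.

(** * Borel sets of R^d are Lebesgue measurable *)

Section lebesgue_borel.
Context (R : realType) (d : nat).
Local Notation V := 'rV[R]_d.

Definition box_below (i : 'I_d) (t : R) (p : option (V * V)) :=
  omap (fun ab : V * V => (ab.1, \row_j
    if j == i then Num.min (ab.2 ord0 j) t else ab.2 ord0 j) : V * V) p.

Definition box_above (i : 'I_d) (t : R) (p : option (V * V)) :=
  omap (fun ab : V * V => (\row_j
    if j == i then Num.max (ab.1 ord0 j) t else ab.1 ord0 j, ab.2) : V * V) p.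

(** Both halves are closed boxes; their overlap in the hyperplane has volume
    zero, and a half that is empty gets a negative side, which [box_vol]
    truncates. *)
Lemma box_vol_split i t p :
  (box_vol (box_below i t p) + box_vol (box_above i t p) <= box_vol p)%E.
Proof.
case: p => [[a b]|] /=; last by rewrite adde0.
rewrite -EFinD lee_fin [X in X + _ <= _](bigD1 i)//=.
rewrite [X in _ + X <= _](bigD1 i)//= [leRHS](bigD1 i)//= !mxE eqxx.
under [X in _ * X + _]eq_bigr => j /negbTE ji do rewrite mxE ji.
under [X in _ + _ * X]eq_bigr => j /negbTE ji do rewrite mxE ji.
rewrite -mulrDl ler_wpM2r//.
  by apply: prodr_ge0 => j _; rewrite le_max lexx.
rewrite /Num.min /Num.max; do !case: ifPn => //; rewrite -?leNgt; lra.
Qed.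

(** A covering of [X] by boxes is cut into coverings of [X `&` A] and
    [X `\` A] of the same total volume, so that the outer measure is
    additive along [A]. The hypotheses leave it open which part of the
    hyperplane belongs to [A]. *)
Lemma measurable_halfspace (i : 'I_d) (t : R) (A : set V) :
  [set x : V | x ord0 i < t] `<=` A -> A `<=` [set x : V | x ord0 i <= t] ->
  measurable (A : set (lrV R d)).
Proof.
move=> tA At; apply: le_caratheodory_measurable => X.
apply: le_ereal_inf_tmp => _ [F XF <-].
have XA : (leb_outer (X `&` A) <= \sum_(k <oo) box_vol (box_below i t (F k)))%E.
  apply: ereal_inf_lbound; exists (box_below i t \o F) => //.
  move=> x [Xx Ax]; have [k _ Fkx] := XF _ Xx; exists k => //=.
  case: (F k) Fkx => [[a b]|]//= abx j; have := abx j; rewrite mxE.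
  case: eqP => // -> /andP[-> xb]/=; rewrite le_min xb; exact: At.
have XAC : (leb_outer (X `&` ~` A) <=
    \sum_(k <oo) box_vol (box_above i t (F k)))%E.
  apply: ereal_inf_lbound; exists (box_above i t \o F) => //.
  move=> x [Xx Ax]; have [k _ Fkx] := XF _ Xx; exists k => //=.
  case: (F k) Fkx => [[a b]|]//= abx j; have := abx j; rewrite mxE.
  case: eqP => // -> /andP[ax ->]/=; rewrite andbT ge_max ax/=.
  by rewrite leNgt; apply/negP => /tA.
apply: le_trans (leeD XA XAC) _.
rewrite -nneseriesD; [|by move=> *; exact: box_vol_ge0..].
apply: lee_nneseries => [k _ _|k _]; last exact: box_vol_split.
by apply: adde_ge0; exact: box_vol_ge0.
Qed.

Lemma measurable_box p : measurable (box p : set (lrV R d)).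
Proof.
case: p => [[a b]|]; last exact: measurable0.
rewrite (_ : box (Some (a, b)) = \bigcap_(i in [set: 'I_d])
  (~` [set x : V | x ord0 i < a ord0 i] `&`
   [set x : V | x ord0 i <= b ord0 i])).
  apply: fin_bigcap_measurable => // i _; apply: measurableI.
    apply: measurableC; apply: (@measurable_halfspace i (a ord0 i)) => x //=.
    exact: ltW.
  by apply: (@measurable_halfspace i (b ord0 i)) => x //=; exact: ltW.
apply/seteqP; split=> x /= abx i; have := abx i.
  by move=> /andP[ax xb] _; split => //=; apply/negP; rewrite -leNgt.
by move=> /(_ I)[/= /negP]; rewrite -leNgt => -> ->.
Qed.

Lemma compact_box p : compact (box p : set V).
Proof.
case: p => [[a b]|]; last exact: compact0.
rewrite (_ : box (Some (a, b)) =
    [set v : V | forall i, `[a ord0 i, b ord0 i]%classic (v ord0 i)]).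
  apply: (@rV_compact _ _ (fun i => `[a ord0 i, b ord0 i]%classic)) => i.
  exact: segment_compact.
by apply/seteqP; split=> x /= abx i; have := abx i; rewrite in_itv.
Qed.

(** The boxes with rational corners that are contained in [U]; being
    compact, they also reduce properties over [U] to properties over compact
    subsets. *)
Lemma open_exhaustion (U : set V) : open U ->
  exists F : nat -> option (V * V),
    U = \bigcup_k box (F k) /\ forall k, box (F k) `<=` U.
Proof.
move=> oU.
pose toV (q : 'rV[rat]_d) : V := map_mx ratr q.
pose F k := if @unpickle ('rV[rat]_d * 'rV[rat]_d)%type k is Some p then
  if `[< box (Some (toV p.1, toV p.2)) `<=` U >]
  then Some (toV p.1, toV p.2) else None else None.
have FU k : box (F k) `<=` U.
  rewrite /F; case: unpickle => [p|]; [case: asboolP => // _|]; exact: sub0set.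
exists F; split => //; apply/seteqP; split; last by move=> x [k _ /FU].
move=> x Ux; have /nbhs_ballP[e e0 eU] := open_nbhs_nbhs (conj oU Ux).
have [a ha] : exists a : 'I_d -> rat, forall i,
    ratr (a i) \in `](x ord0 i - e), (x ord0 i)[.
  have /choice[a ha] : forall i, exists q : rat,
      ratr q \in `](x ord0 i - e), (x ord0 i)[.
    by move=> i; apply: rat_in_itvoo; rewrite ltrBlDr ltrDl.
  by exists a.
have [b hb] : exists b : 'I_d -> rat, forall i,
    ratr (b i) \in `](x ord0 i), (x ord0 i + e)[.
  have /choice[b hb] : forall i, exists q : rat,
      ratr q \in `](x ord0 i), (x ord0 i + e)[.
    by move=> i; apply: rat_in_itvoo; rewrite ltrDl.
  by exists b.
exists (pickle (\row_i a i, \row_i b i)) => //.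
rewrite /F pickleK /=; case: asboolP => [_ i|abs].
  rewrite !mxE; have := ha i; have := hb i.
  by rewrite !in_itv/= => /andP[/ltW-> _] /andP[_ /ltW->].
exfalso; apply: abs => y /= aby; apply: eU; split => // i j.
have := aby j; have := ha j; have := hb j; rewrite !mxE !in_itv/=.
move=> /andP[_ h1] /andP[h2 _] /andP[h3 h4]; rewrite (ord1 i).
rewrite /ball/= ltr_norml; lra.
Qed.

Lemma open_measurable_lrV (U : set V) :
  open U -> measurable (U : set (lrV R d)).
Proof.
move=> /open_exhaustion[F [-> _]]; apply: bigcupT_measurable => k.
exact: measurable_box.
Qed.

Lemma closed_measurable_lrV (U : set V) :
  closed U -> measurable (U : set (lrV R d)).
Proof.
by move=> /closed_openC/open_measurable_lrV/measurableC; rewrite setCK.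
Qed.

Lemma compact_measurable_lrV (U : set V) :
  compact U -> measurable (U : set (lrV R d)).
Proof.
by move=> /compact_closed cU; apply/closed_measurable_lrV/cU/norm_hausdorff.
Qed.

Lemma continuous_measurable_lrV (f : V -> R) : continuous f ->
  measurable_fun setT (f : lrV R d -> R).
Proof.
move=> /continuousP cf; apply: (measurability _ (RGenOpens.measurableE R)).
move=> _ [_ [a [b ->] <-]]; rewrite setTI; apply: open_measurable_lrV.
exact/cf/interval_open.
Qed.

End lebesgue_borel.

(** * The complex L2 space of a measurable set *)

Section complex_parts.
Context (R : rcfType).
Local Notation Re := (@complex.Re R).
Local Notation Im := (@complex.Im R).

Lemma ReD z w : Re (z + w) = Re z + Re w. Proof. by case: z w => ? ? []. Qed.
Lemma ImD z w : Im (z + w) = Im z + Im w. Proof. by case: z w => ? ? []. Qed.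
Lemma ReM z w : Re (z * w) = Re z * Re w - Im z * Im w.
Proof. by case: z w => ? ? []. Qed.
Lemma ImM z w : Im (z * w) = Re z * Im w + Im z * Re w.
Proof. by case: z w => ? ? []. Qed.
Lemma ReN z : Re (- z) = - Re z. Proof. by case: z. Qed.
Lemma ImN z : Im (- z) = - Im z. Proof. by case: z. Qed.
Lemma ReJ z : Re (conjc z) = Re z. Proof. by case: z. Qed.
Lemma ImJ z : Im (conjc z) = - Im z. Proof. by case: z. Qed.

Lemma complexP (z w : R[i]) : Re z = Re w -> Im z = Im w -> z = w.
Proof. by case: z w => ? ? [? ?] /= -> ->. Qed.

Lemma normc_sqr z : ComplexField.Normc.normc z ^+ 2 = Re z ^+ 2 + Im z ^+ 2.
Proof.
case: z => a b; rewrite /ComplexField.Normc.normc sqr_sqrtr//.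
by rewrite addr_ge0 ?sqr_ge0.
Qed.

Lemma normc_triangle (z w : R[i]) : ComplexField.Normc.normc (z + w) <=
  ComplexField.Normc.normc z + ComplexField.Normc.normc w.
Proof.
by have := ler_normD z w; rewrite !normc_def -rmorphD lecR; case: z w => ? ? [].
Qed.

End complex_parts.

#[global] Instance leb_ae_filter (R : realType) d :
  Filter (nbhs (almost_everywhere (leb R d))).
Proof. exact: (ae_filter_ringOfSetsType (leb R d)). Qed.

Section complex_L2.
Context (R : realType) (d : nat).
Local Notation C := R[i].
Local Notation V := 'rV[R]_d.
Local Notation F := (V -> C).
Local Notation mu := (leb R d).
Local Notation Re := (@complex.Re R).
Local Notation Im := (@complex.Im R).
Context (D : set V) (mD : measurable (D : set (lrV R d))).
Implicit Types (f g h : F).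
Local Notation rint := (@rintegrable _ (lrV R d) R mu D).
Local Notation sqi := (@sqint _ (lrV R d) R mu D).
Local Notation I := (@Rintegral _ (lrV R d) R mu D).

Lemma cintegrableP f :
  cintegrable D f <-> rint (fun x => Re (f x)) /\ rint (fun x => Im (f x)).
Proof. by []. Qed.

Lemma cintegrable_cmeasurable f : cintegrable D f -> cmeasurable D f.
Proof.
move=> /cintegrableP[fr fi].
by split; [move: fr|move: fi]; exact: rintegrable_meas.
Qed.

Lemma cintegrableD f g : cintegrable D f -> cintegrable D g ->
  cintegrable D (fun x => f x + g x).
Proof.
move=> /cintegrableP[fr fi] /cintegrableP[gr gi]; apply/cintegrableP; split.
  under [X in rintegrable _ _ X]eq_fun do rewrite ReD.
  exact: (rintegrableD mD fr gr).
under [X in rintegrable _ _ X]eq_fun do rewrite ImD.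
exact: (rintegrableD mD fi gi).
Qed.

Lemma cintegrableZ c f : cintegrable D f -> cintegrable D (fun x => c * f x).
Proof.
move=> /cintegrableP[fr fi]; apply/cintegrableP; split.
  under [X in rintegrable _ _ X]eq_fun do rewrite ReM.
  exact: (rintegrableB mD (rintegrableZ mD _ fr) (rintegrableZ mD _ fi)).
under [X in rintegrable _ _ X]eq_fun do rewrite ImM.
exact: (rintegrableD mD (rintegrableZ mD _ fi) (rintegrableZ mD _ fr)).
Qed.

Lemma cintegralD f g : cintegrable D f -> cintegrable D g ->
  cintegral D (fun x => f x + g x) = cintegral D f + cintegral D g.
Proof.
move=> /cintegrableP[fr fi] /cintegrableP[gr gi].
apply: complexP; rewrite /cintegral /=.
  by under eq_Rintegral do rewrite ReD; rewrite RintegralD.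
by under eq_Rintegral do rewrite ImD; rewrite RintegralD.
Qed.

Lemma cintegralZ c f : cintegrable D f ->
  cintegral D (fun x => c * f x) = c * cintegral D f.
Proof.
move=> /cintegrableP[fr fi]; apply: complexP; rewrite ?ReM ?ImM /cintegral /=.
  under eq_Rintegral do rewrite ReM.
  by rewrite RintegralB ?RintegralZl//; exact: rintegrableZ.
under eq_Rintegral do rewrite ImM.
by rewrite RintegralD ?RintegralZl//; exact: rintegrableZ.
Qed.

Lemma cintegral_conj f : cintegrable D f ->
  cintegral D (fun x => conjc (f x)) = conjc (cintegral D f).
Proof.
move=> /cintegrableP[fr fi]; apply: complexP; rewrite ?ReJ ?ImJ /cintegral /=.
  by under eq_Rintegral do rewrite ReJ.
under eq_Rintegral do rewrite ImJ -mulN1r.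
by rewrite RintegralZl// mulN1r.
Qed.

Lemma L2spaceP f :
  L2space D f <-> sqi (fun x => Re (f x)) /\ sqi (fun x => Im (f x)).
Proof.
have nE x : (ComplexField.Normc.normc (f x) ^+ 2)%:E =
    ((Re (f x) ^+ 2)%:E + (Im (f x) ^+ 2)%:E)%E by rewrite normc_sqr EFinD.
split=> [[[mr mi]]|[[mr [fr]] [mi fi]]]; last first.
  split=> //; under eq_integral do rewrite nE.
  rewrite ge0_integralD//.
  - apply: lte_add_pinfty.
    + have := integrable_lty mD fr; apply: le_lt_trans.
      by [].
    + exact: (integrable_lty mD fi).
  - by move=> x _; rewrite lee_fin sqr_ge0.
  - by apply/measurable_EFinP; exact: measurable_funX.
  - by move=> x _; rewrite lee_fin sqr_ge0.
  - by apply/measurable_EFinP; exact: measurable_funX.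
under eq_integral do rewrite nE.
move=> foo.
have mr2 : measurable_fun (D : set (lrV R d)) (fun x => (Re (f x) ^+ 2)%:E).
  by apply/measurable_EFinP; exact: measurable_funX.
have mi2 : measurable_fun (D : set (lrV R d)) (fun x => (Im (f x) ^+ 2)%:E).
  by apply/measurable_EFinP; exact: measurable_funX.
split; split => //; apply/integrableP; split => //; apply: le_lt_trans foo.
  refine (@ge0_le_integral _ _ _ mu D mD _ _ _ _ _ _).
  - by move=> x _; exact: abse_ge0.
  - exact: (measurableT_comp (@abse_measurable R setT) mr2).
  - exact: emeasurable_funD mr2 mi2.
  - by move=> x _ /=; rewrite ger0_norm ?sqr_ge0// leeDl// lee_fin sqr_ge0.
refine (@ge0_le_integral _ _ _ mu D mD _ _ _ _ _ _).
- by move=> x _; exact: abse_ge0.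
- exact: (measurableT_comp (@abse_measurable R setT) mi2).
- exact: emeasurable_funD mr2 mi2.
- by move=> x _ /=; rewrite ger0_norm ?sqr_ge0// leeDr// lee_fin sqr_ge0.
Qed.

#[local] Opaque L2space.

Lemma L2spaceD f g : L2space D f -> L2space D g ->
  L2space D (fun x => f x + g x).
Proof.
move=> /L2spaceP[fr fi] /L2spaceP[gr gi]; apply/L2spaceP; split.
  under [X in sqint _ _ X]eq_fun do rewrite ReD; exact: (sqintD mD fr gr).
under [X in sqint _ _ X]eq_fun do rewrite ImD; exact: (sqintD mD fi gi).
Qed.

Lemma L2spaceZ c f : L2space D f -> L2space D (fun x => c * f x).
Proof.
move=> /L2spaceP[fr fi]; apply/L2spaceP; split.
  under [X in sqint _ _ X]eq_fun do rewrite ReM.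
  exact: (sqintB mD (sqintZ mD _ fr) (sqintZ mD _ fi)).
under [X in sqint _ _ X]eq_fun do rewrite ImM.
exact: (sqintD mD (sqintZ mD _ fi) (sqintZ mD _ fr)).
Qed.

Lemma L2spaceB f g : L2space D f -> L2space D g ->
  L2space D (fun x => f x - g x).
Proof.
move=> Lf Lg; have := L2spaceD Lf (L2spaceZ (-1) Lg).
by under eq_fun do rewrite mulN1r.
Qed.

Lemma L2space_prod f g : L2space D f -> L2space D g ->
  cintegrable D (fun x => f x * conjc (g x)).
Proof.
move=> /L2spaceP[fr fi] /L2spaceP[gr gi]; apply/cintegrableP; split.
  under [X in rintegrable _ _ X]eq_fun do rewrite ReM ReJ ImJ mulrN opprK.
  exact: (rintegrableD mD (sqint_mul mD fr gr) (sqint_mul mD fi gi)).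
under [X in rintegrable _ _ X]eq_fun do rewrite ImM ReJ ImJ mulrN addrC.
exact: (rintegrableB mD (sqint_mul mD fi gr) (sqint_mul mD fr gi)).
Qed.

Lemma cintegral_ae f g : cmeasurable D f -> cmeasurable D g -> eq_ae D f g ->
  cintegral D f = cintegral D g.
Proof.
move=> [fr fi] [gr gi] fg; rewrite /cintegral /Rintegral; congr (_ +i* _)%C.
  congr fine; apply: (@ae_eq_integral _ _ R mu D _ _ mD);
    try exact/measurable_EFinP.
  by apply: filterS fg => x fg Dx; rewrite fg.
congr fine; apply: (@ae_eq_integral _ _ R mu D _ _ mD);
  try exact/measurable_EFinP.
by apply: filterS fg => x fg Dx; rewrite fg.
Qed.

Lemma Re_innerE f g : L2space D f -> L2space D g ->
  Re (inner D f g) = I (fun x => Re (f x) * Re (g x)) +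
                     I (fun x => Im (f x) * Im (g x)).
Proof.
move=> /L2spaceP[fr fi] /L2spaceP[gr gi].
rewrite -(RintegralD mD (sqint_mul mD fr gr) (sqint_mul mD fi gi)).
by apply: eq_Rintegral => x _; rewrite ReM ReJ ImJ mulrN opprK.
Qed.

#[local] Opaque cintegral cintegrable.

Lemma innerDl f g h : L2space D f -> L2space D g -> L2space D h ->
  inner D (fun x => f x + g x) h = inner D f h + inner D g h.
Proof.
move=> Lf Lg Lh; rewrite /inner -cintegralD; [|exact: L2space_prod..].
by congr cintegral; apply/funext => x; rewrite mulrDl.
Qed.

Lemma innerZl c f h : L2space D f -> L2space D h ->
  inner D (fun x => c * f x) h = c * inner D f h.
Proof.
move=> Lf Lh; rewrite /inner -cintegralZ; last exact: L2space_prod.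
by congr cintegral; apply/funext => x; rewrite mulrA.
Qed.

Lemma inner_conj f g : L2space D f -> L2space D g ->
  inner D g f = conjc (inner D f g).
Proof.
move=> Lf Lg; rewrite /inner -cintegral_conj; last exact: L2space_prod.
by congr cintegral; apply/funext => x; rewrite rmorphM /= conjcK mulrC.
Qed.

Lemma innerDr f g h : L2space D f -> L2space D g -> L2space D h ->
  inner D h (fun x => f x + g x) = inner D h f + inner D h g.
Proof.
move=> Lf Lg Lh; rewrite (inner_conj (L2spaceD Lf Lg) Lh) innerDl// rmorphD /=.
by rewrite -(inner_conj Lf Lh) -(inner_conj Lg Lh).
Qed.

Lemma innerZr c f h : L2space D f -> L2space D h ->
  inner D h (fun x => c * f x) = conjc c * inner D h f.
Proof.
move=> Lf Lh; rewrite (inner_conj (L2spaceZ c Lf) Lh) innerZl// rmorphM /=.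
by rewrite -(inner_conj Lf Lh).
Qed.

Lemma Re_inner_sqr f : L2space D f ->
  Re (inner D f f) = I (fun x => Re (f x) ^+ 2) + I (fun x => Im (f x) ^+ 2).
Proof. by move=> Lf; rewrite Re_innerE. Qed.

Lemma Re_inner_ge0 f : L2space D f -> 0 <= Re (inner D f f).
Proof.
by move=> Lf; rewrite Re_inner_sqr// addr_ge0//; apply: Rintegral_ge0 => x _;
   exact: sqr_ge0.
Qed.

Lemma L2norm_sqr f : L2space D f -> L2norm D f ^+ 2 = Re (inner D f f).
Proof. by move=> Lf; rewrite sqr_sqrtr// Re_inner_ge0. Qed.

Lemma inner_ael f f' g : L2space D f -> L2space D f' -> L2space D g ->
  eq_ae D f f' -> inner D f g = inner D f' g.
Proof.
move=> Lf Lf' Lg ff'; apply: cintegral_ae.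
- exact/cintegrable_cmeasurable/L2space_prod.
- exact/cintegrable_cmeasurable/L2space_prod.
- by apply: filterS ff' => x ff' Dx; rewrite ff'.
Qed.

Lemma inner_aer f f' g : L2space D f -> L2space D f' -> L2space D g ->
  eq_ae D f f' -> inner D g f = inner D g f'.
Proof.
move=> Lf Lf' Lg ff'; rewrite (inner_conj Lf Lg) (inner_ael Lf Lf' Lg ff').
by rewrite -(inner_conj Lf' Lg).
Qed.

(** The real and imaginary parts satisfy the same bound on increments. *)
Lemma L2space_complete (f : nat -> F) (K : R) : (forall k, L2space D (f k)) ->
  (forall k, Re (inner D (fun x => f k x - f k.+1 x)
                         (fun x => f k x - f k.+1 x)) <= K * 16%:R ^- k) ->
  exists2 g, L2space D g &
    (fun k => Re (inner D (fun x => f k x - g x) (fun x => f k x - g x)))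
      @ \oo --> (0 : R).
Proof.
move=> Lf fK.
have fr k : sqi (fun x => Re (f k x)) by case/L2spaceP: (Lf k).
have fi k : sqi (fun x => Im (f k x)) by case/L2spaceP: (Lf k).
have split2 g h : L2space D g -> L2space D h ->
    Re (inner D (fun x => g x - h x) (fun x => g x - h x)) =
    I (fun x => (Re (g x) - Re (h x)) ^+ 2) +
    I (fun x => (Im (g x) - Im (h x)) ^+ 2).
  move=> Lg Lh; rewrite Re_inner_sqr; last exact: L2spaceB.
  by congr (_ + _); apply: eq_Rintegral => x _; rewrite ?ReD ?ReN ?ImD ?ImN.
have sq0 (u v : lrV R d -> R) : 0 <= I (fun x => (u x - v x) ^+ 2).
  by apply: Rintegral_ge0 => x _; exact: sqr_ge0.
have [gr sgr [Kr grK]] : exists2 g, sqi g & exists K, forall k,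
    I (fun x => (Re (f k x) - g x) ^+ 2) <= K * 4^-1 ^+ k.
  apply: (@sqint_complete _ _ _ mu D mD (fun k x => Re (f k x)) K) => // k.
  by apply: le_trans (fK k); rewrite split2// lerDl.
have [gi sgi [Ki giK]] : exists2 g, sqi g & exists K, forall k,
    I (fun x => (Im (f k x) - g x) ^+ 2) <= K * 4^-1 ^+ k.
  apply: (@sqint_complete _ _ _ mu D mD (fun k x => Im (f k x)) K) => // k.
  by apply: le_trans (fK k); rewrite split2// lerDr.
exists (fun x => gr x +i* gi x)%C; first exact/L2spaceP.
apply: (@squeeze_cvgr _ _ _ _ (fun=> 0) (fun k => (Kr + Ki) * 4^-1 ^+ k)).
- near=> k; rewrite split2//; last exact/L2spaceP.
  by rewrite addr_ge0//= mulrDl lerD.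
- exact: cvg_cst.
- apply: (@cvg0_scale _ (Kr + Ki) (fun k => 4^-1 ^+ k)) => //.
  by apply: cvg_expr; rewrite ger0_norm// invf_lt1// ltr1n.
Unshelve. all: by end_near. Qed.

End complex_L2.

(** * Smooth functions and their directional derivatives *)

Lemma is_derive_line (R : realType) (V : normedModType R) (f : V -> R)
    (v x : V) : (forall y, derivable f y v) -> forall t : R,
  is_derive t 1 (fun h : R => f (h *: v + x)) ('D_v f (t *: v + x)).
Proof.
move=> df t.
have E : (fun h : R => h^-1 *:
     (((fun s : R => f (s *: v + x)) \o shift t) (h *: 1) - f (t *: v + x))) =
   (fun h : R => h^-1 *:
     ((f \o shift (t *: v + x)) (h *: v) - f (t *: v + x))).
  by apply/funext => h /=; rewrite [h *: 1]mulr1 scalerDl addrA.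
by split; rewrite /derivable /derive E; [exact: df|].
Qed.

Lemma mean_value_at0 (R : realType) (phi dphi : R -> R) :
  (forall t : R, is_derive t 1 phi (dphi t)) ->
  forall h, exists2 c, `|c| <= `|h| & phi h - phi 0 = dphi c * h.
Proof.
move=> dp h.
have cp : continuous phi.
  move=> t; apply/differentiable_continuous/derivable1_diffP.
  exact: ex_derive.
have [h0|h0] := leP 0 h.
  have [|c ci E] := MVT_segment h0 (fun x _ => dp x).
    exact: continuous_subspaceT.
  exists c; last by rewrite E subr0.
  by move: ci; rewrite in_itv/= => /andP[c0 ch]; rewrite !ger0_norm.
have [|c ci E] := MVT_segment (ltW h0) (fun x _ => dp x).
  exact: continuous_subspaceT.
exists c; last by rewrite -opprB E sub0r mulrN opprK.
by move: ci; rewrite in_itv/= => /andP[c0 ch]; rewrite !ler0_norm ?lerN2// ltW.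
Qed.

(** The increment in the second direction is taken at the displaced point,
    where the mean value theorem turns it into a value of the derivative
    close by. *)
Lemma is_derive_add_dir (R : realType) (V : normedModType R) (f : V -> R)
    (a b : V) (c : R) x (da : R) :
  is_derive x a f da -> (forall y, derivable f y b) ->
  {for x, continuous ('D_b f)} ->
  is_derive x (a + c *: b) f (da + c * 'D_b f x).
Proof.
move=> [dfa dva] dfb cb.
have pa : (fun h : R => h^-1 *: (f (h *: a + x) - f x)) @ 0^' --> da.
  by rewrite -dva; exact: dfa.
have pb : (fun h : R => h^-1 *: (f (h *: (a + c *: b) + x) - f (h *: a + x)))
    @ 0^' --> c * 'D_b f x.
  apply/cvgrPdist_lt => e e0.
  have c1 : 0 < `|c| + 1 by rewrite ltr_wpDl.
  have ec : 0 < e / (`|c| + 1) by rewrite divr_gt0.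
  have /(cvgrPdist_lt _ _)/(_ _ ec)/nbhs_ballP[del del0 hdel] := cb.
  have ab0 : 0 < `|a| + `|c| * `|b| + 1 by rewrite ltr_wpDl ?addr_ge0 ?mulr_ge0.
  near=> h.
  have h0 : h != 0 by near: h; exact: nbhs_dnbhs_neq.
  have hlt : `|h| < del / (`|a| + `|c| * `|b| + 1).
    near: h; apply: dnbhs0_lt; by rewrite divr_gt0.
  have [s sh E] := mean_value_at0 (is_derive_line (h *: a + x) dfb) (h * c).
  have -> : h *: (a + c *: b) + x = (h * c) *: b + (h *: a + x).
    by rewrite scalerDr scalerA addrCA addrA.
  rewrite scale0r add0r in E; rewrite E.
  have -> : h^-1 *: ('D_b f (s *: b + (h *: a + x)) * (h * c)) =
      c * 'D_b f (s *: b + (h *: a + x)) by rewrite /GRing.scale/=; field.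
  have hX : `|'D_b f x - 'D_b f (s *: b + (h *: a + x))| < e / (`|c| + 1).
    apply: hdel; rewrite -ball_normE /ball_ /= addrA opprD addrCA subrr addr0.
    rewrite normrN; apply: le_lt_trans (ler_normD _ _) _; rewrite !normrZ.
    have hd : `|h| * (`|a| + `|c| * `|b| + 1) < del by rewrite -ltr_pdivlMr.
    apply: le_lt_trans hd; have : `|s| * `|b| <= `|h| * `|c| * `|b|.
      by rewrite ler_wpM2r// -normrM.
    have := normr_ge0 h; lra.
  rewrite -mulrBr normrM.
  apply: (@le_lt_trans _ _ ((`|c| + 1) *
      `|'D_b f x - 'D_b f (s *: b + (h *: a + x))|)).
    by rewrite ler_wpM2r// lerDl.
  by rewrite mulrC -ltr_pdivlMr.
have E : (fun h : R => h^-1 *: ((f \o shift x) (h *: (a + c *: b)) - f x)) =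
   (fun h : R => h^-1 *: (f (h *: a + x) - f x) +
      h^-1 *: (f (h *: (a + c *: b) + x) - f (h *: a + x))).
  by apply/funext => h /=; rewrite -scalerDr; congr (_ *: _); ring.
have L : (fun h : R => h^-1 *: (f (h *: a + x) - f x) +
      h^-1 *: (f (h *: (a + c *: b) + x) - f (h *: a + x))) @ 0^'
    --> da + c * 'D_b f x by exact: cvgD pa pb.
split; rewrite /derivable /derive E; first exact: cvgP L.
exact: cvg_lim L.
Unshelve. all: by end_near. Qed.

Section smooth_functions.
Context (R : realType) (d : nat).
Local Notation V := 'rV[R]_d.
Implicit Types (f g : V -> R).
Local Notation e_ := (@unitv R d).

Definition smooth f := forall k, rCk k setT f.

Lemma rCkT0 f : rCk 0 setT f <-> continuous f.
Proof.
by split=> [[cf _] x|cf]; [apply: cf; rewrite inE|split=> // x _; exact: cf].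
Qed.

Lemma rCkTS k f : rCk k.+1 setT f <-> continuous f /\
  forall j, (forall x, derivable f x (e_ j)) /\ rCk k setT ('D_(e_ j) f).
Proof.
split=> [[cf df]|[cf df]].
  split=> [x|j]; first by apply: cf; rewrite inE.
  by have [dj ?] := df j; split=> // x; exact: dj.
by split=> [x _|j]; [exact: cf|have [dj ?] := df j; split].
Qed.

Lemma rCkTW k f : rCk k.+1 setT f -> rCk k setT f.
Proof.
elim: k f => [f /rCkTS[cf _]|k ih f /rCkTS[cf df]]; first exact/rCkT0.
by apply/rCkTS; split=> // j; have [dj ?] := df j; split=> //; exact: ih.
Qed.

Lemma smooth_continuous f : smooth f -> continuous f.
Proof. by move=> /(_ 0%N)/rCkT0. Qed.

Lemma smooth_derivable f : smooth f -> forall j x, derivable f x (e_ j).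
Proof. by move=> /(_ 1%N)/rCkTS[_ df] j; case: (df j). Qed.

Lemma smooth_partial f j : smooth f -> smooth ('D_(e_ j) f).
Proof. by move=> sf k; have /rCkTS[_ /(_ j)[]] := sf k.+1. Qed.

(** Coinduction: a class of functions with partial derivatives in the class. *)
Lemma smooth_coind (P : (V -> R) -> Prop) :
  (forall f, P f -> continuous f /\
     forall j, (forall x, derivable f x (e_ j)) /\ P ('D_(e_ j) f)) ->
  forall f, P f -> smooth f.
Proof.
move=> Pcoind f Pf k; elim: k f Pf => [f /Pcoind[cf _]|k ih f /Pcoind[cf df]].
  exact/rCkT0.
by apply/rCkTS; split=> // j; have [? ?] := df j; split=> //; exact: ih.
Qed.

Lemma rCkTD k f g : rCk k setT f -> rCk k setT g ->
  rCk k setT (fun x => f x + g x).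
Proof.
elim: k f g => [f g /rCkT0 cf /rCkT0 cg|k ih f g /rCkTS[cf df] /rCkTS[cg dg]].
  by apply/rCkT0 => x; exact: (continuousD (cf x) (cg x)).
apply/rCkTS; split; first by move=> x; exact: (continuousD (cf x) (cg x)).
move=> j; have [df1 df2] := df j; have [dg1 dg2] := dg j; split.
  by move=> x; exact: (derivableD (df1 x) (dg1 x)).
have -> : 'D_(e_ j) (fun x => f x + g x) =
    fun x => 'D_(e_ j) f x + 'D_(e_ j) g x.
  by apply/funext => x; exact: (deriveD (df1 x) (dg1 x)).
exact: ih.
Qed.

Lemma rCkTM k f g : rCk k setT f -> rCk k setT g ->
  rCk k setT (fun x => f x * g x).
Proof.
elim: k f g => [f g /rCkT0 cf /rCkT0 cg|k ih f g Cf Cg].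
  by apply/rCkT0 => x; exact: (continuousM (cf x) (cg x)).
have /rCkTS[cf df] := Cf; have /rCkTS[cg dg] := Cg.
apply/rCkTS; split; first by move=> x; exact: (continuousM (cf x) (cg x)).
move=> j; have [df1 df2] := df j; have [dg1 dg2] := dg j; split.
  by move=> x; exact: (derivableM (df1 x) (dg1 x)).
have -> : 'D_(e_ j) (fun x => f x * g x) =
    fun x => f x * 'D_(e_ j) g x + g x * 'D_(e_ j) f x.
  by apply/funext => x; exact: (deriveM (df1 x) (dg1 x)).
by apply: rCkTD; apply: ih => //; exact: rCkTW.
Qed.

Lemma smoothD f g : smooth f -> smooth g -> smooth (fun x => f x + g x).
Proof. by move=> sf sg k; exact: rCkTD. Qed.

Lemma smoothM f g : smooth f -> smooth g -> smooth (fun x => f x * g x).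
Proof. by move=> sf sg k; exact: rCkTM. Qed.

Lemma smooth_cst (a : R) : smooth (fun=> a).
Proof.
apply: (@smooth_coind (fun f => exists b, f = cst b)); last by exists a.
move=> _ [b ->]; split; first by move=> x; exact: cst_continuous.
move=> j; split; first by move=> x; exact: derivable_cst.
by exists 0; apply/funext => x; exact: derive_cst.
Qed.

Lemma smoothN f : smooth f -> smooth (fun x => - f x).
Proof.
move=> sf; have := smoothM (smooth_cst (-1)) sf.
by under eq_fun do rewrite mulN1r.
Qed.

(** One coordinate direction is added at a time. *)
Lemma smooth_is_derive f : smooth f -> forall v x,
  is_derive x v f (\sum_j v ord0 j * 'D_(e_ j) f x).
Proof.
move=> sf v x; rewrite [v in is_derive x v]row_sum_delta.
elim: (index_enum _) => [|j s ih]; first by rewrite !big_nil; exact: is_derive0.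
rewrite !big_cons addrC [X in is_derive _ _ _ X]addrC.
apply: is_derive_add_dir => //; first exact: smooth_derivable.
exact: (smooth_continuous (smooth_partial j sf)).
Qed.

Lemma smooth_derivable_dir f : smooth f -> forall v x, derivable f x v.
Proof. by move=> sf v x; have := smooth_is_derive sf v x; case. Qed.

Lemma smooth_dir f v : smooth f -> smooth ('D_v f).
Proof.
move=> sf; have -> : 'D_v f = fun x => \sum_j v ord0 j * 'D_(e_ j) f x.
  by apply/funext => x; have := smooth_is_derive sf v x; case.
elim: (index_enum _) => [|j s ih].
  by under eq_fun do rewrite big_nil; exact: smooth_cst.
under eq_fun do rewrite big_cons.
apply: smoothD ih; apply: smoothM (smooth_partial j sf); exact: smooth_cst.
Qed.

Lemma dotvD (theta : V) x y : dotv theta (x + y) = dotv theta x + dotv theta y.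
Proof.
by rewrite /dotv -big_split; apply: eq_bigr => i _; rewrite mxE mulrDr.
Qed.

Lemma dotvZ (theta : V) a x : dotv theta (a *: x) = a * dotv theta x.
Proof.
by rewrite /dotv mulr_sumr; apply: eq_bigr => i _; rewrite mxE mulrCA.
Qed.

Lemma dotvN (theta : V) x : dotv (- theta) x = - dotv theta x.
Proof.
by rewrite /dotv -sumrN; apply: eq_bigr => i _; rewrite mxE mulNr.
Qed.

Lemma dotv_unitv (theta : V) j : dotv theta (e_ j) = theta ord0 j.
Proof.
rewrite /dotv (bigD1 j)//= big1 => [|i ij].
  by rewrite /unitv mxE !eqxx addr0 mulr1.
by rewrite /unitv mxE eqxx (negbTE ij) mulr0.
Qed.

Lemma continuous_dotv (theta : V) : continuous (dotv theta).
Proof.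
move=> x; rewrite /dotv; elim: (index_enum _) => [|j s ih].
  by under eq_fun do rewrite big_nil; exact: cst_continuous.
under eq_fun do rewrite big_cons.
apply: (@continuousD _ _ _ (fun y : V => theta ord0 j * y ord0 j)) ih.
apply: (@continuousM _ _ (cst (theta ord0 j)) (fun y : V => y ord0 j)).
  exact: cst_continuous.
exact: coord_continuous.
Qed.

(** Along the line through [x] the inner argument is affine. *)
Lemma is_derive_dotv (theta v x : V) (phi : R -> R) (dphi : R) :
  is_derive (dotv theta x) 1 phi dphi ->
  is_derive x v (fun y => phi (dotv theta y)) (dphi * dotv theta v).
Proof.
move=> dp; pose a := dotv theta v; pose b := dotv theta x.
have [d1 d2] : is_derive (0 : R) 1 (phi \o (fun h => h * a + b)) (dphi * a).
  apply: is_derive1_comp; first by rewrite mul0r add0r.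
  have -> : (fun h : R => h * a + b) = a *: (id : R -> R) + cst b.
    by apply/funext => h; rewrite mulrC.
  have := is_deriveD (is_deriveZ a (is_derive_id (0 : R) 1))
    (is_derive_cst b (0 : R) 1).
  by rewrite addr0 [a *: 1]mulr1.
have E : (fun h : R => h^-1 *:
      (((fun y => phi (dotv theta y)) \o shift x) (h *: v)
      - phi (dotv theta x))) =
   (fun h : R => h^-1 *: (((phi \o (fun h => h * a + b)) \o shift 0) (h *: 1)
      - (phi \o (fun h => h * a + b)) 0)).
  apply/funext => h /=; rewrite dotvD dotvZ addr0 [h *: 1]mulr1.
  by rewrite mul0r add0r.
by split; rewrite /derivable /derive E.
Qed.

Lemma smooth_trig (theta : V) :
  smooth (fun x => cos (dotv theta x)) /\ smooth (fun x => sin (dotv theta x)).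
Proof.
(* The span of both functions is stable under partial derivatives. *)
pose P (f : V -> R) := exists a b, f = fun x =>
  a * cos (dotv theta x) + b * sin (dotv theta x).
suff sP : forall f, P f -> smooth f.
  split; apply: sP; [exists 1, 0|exists 0, 1]; apply/funext => x.
    by rewrite mul1r mul0r addr0.
  by rewrite mul1r mul0r add0r.
apply: smooth_coind => _ [a [b ->]]; split.
  move=> x; apply: (@continuousD _ _ _ (fun y => a * cos (dotv theta y))
      (fun y => b * sin (dotv theta y))).
    apply: (@continuousM _ _ (cst a)); first exact: cst_continuous.
    apply: (@continuous_comp _ _ _ (dotv theta)); first exact: continuous_dotv.
    exact: continuous_cos.
  apply: (@continuousM _ _ (cst b)); first exact: cst_continuous.
  apply: (@continuous_comp _ _ _ (dotv theta)); first exact: continuous_dotv.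
  exact: continuous_sin.
move=> j.
have D x : is_derive x (e_ j)
    (fun x => a * cos (dotv theta x) + b * sin (dotv theta x))
    ((b * dotv theta (e_ j)) * cos (dotv theta x) +
     (- a * dotv theta (e_ j)) * sin (dotv theta x)).
  have dc := is_derive_dotv (e_ j) (is_derive_cos (dotv theta x)).
  have ds := is_derive_dotv (e_ j) (is_derive_sin (dotv theta x)).
  apply: is_derive_eq (is_deriveD (is_deriveZ a dc) (is_deriveZ b ds)) _.
  by rewrite /GRing.scale/=; ring.
split; first by move=> x; case: (D x).
exists (b * dotv theta (e_ j)), (- a * dotv theta (e_ j)).
by apply/funext => x; case: (D x).
Qed.

End smooth_functions.

Section complex_smooth.
Context (R : realType) (d : nat).
Local Notation C := R[i].
Local Notation V := 'rV[R]_d.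
Local Notation F := (V -> C).
Local Notation Re := (@complex.Re R).
Local Notation Im := (@complex.Im R).
Implicit Types (f g : F) (v theta : V).

Definition csmooth f :=
  smooth (fun x => Re (f x)) /\ smooth (fun x => Im (f x)).

Lemma csmoothP f : csmooth f <-> forall k, Ck k setT f.
Proof.
by split=> [[sr si] k|s]; [split|split=> k; case: (s k)].
Qed.

Lemma csmoothD f g : csmooth f -> csmooth g -> csmooth (fun x => f x + g x).
Proof.
move=> [fr fi] [gr gi]; split.
  by under eq_fun do rewrite ReD; exact: smoothD.
by under eq_fun do rewrite ImD; exact: smoothD.
Qed.

Lemma csmoothM f g : csmooth f -> csmooth g -> csmooth (fun x => f x * g x).
Proof.
move=> [fr fi] [gr gi]; split.
  under eq_fun do rewrite ReM.
  by apply: smoothD; [exact: smoothM|apply: smoothN; exact: smoothM].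
by under eq_fun do rewrite ImM; apply: smoothD; exact: smoothM.
Qed.

Lemma csmooth_cst c : csmooth (fun=> c).
Proof. by split; exact: smooth_cst. Qed.

Lemma csmooth_cexpi theta : csmooth (cexpi theta).
Proof. by have [? ?] := smooth_trig theta; split. Qed.

Lemma csmooth_cderive v f : csmooth f -> csmooth (cderive v f).
Proof. by move=> [fr fi]; split; exact: smooth_dir. Qed.

Lemma cderiveD v f g : csmooth f -> csmooth g ->
  cderive v (fun x => f x + g x) = fun x => cderive v f x + cderive v g x.
Proof.
move=> [fr fi] [gr gi]; apply/funext => x; apply: complexP.
  rewrite ReD /=; under [X in derive X _ _]eq_fun do rewrite ReD.
  by apply: deriveD; exact: smooth_derivable_dir.
rewrite ImD /=; under [X in derive X _ _]eq_fun do rewrite ImD.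
by apply: deriveD; exact: smooth_derivable_dir.
Qed.

Lemma cderiveM v f g : csmooth f -> csmooth g ->
  cderive v (fun x => f x * g x) =
    fun x => f x * cderive v g x + cderive v f x * g x.
Proof.
move=> [fr fi] [gr gi]; apply/funext => x.
have dM (a b : V -> R) : smooth a -> smooth b ->
    is_derive x v (fun y => a y * b y) (a x * 'D_v b x + b x * 'D_v a x).
  move=> sa sb; apply: is_deriveM; apply: derivableP;
    exact: smooth_derivable_dir.
apply: complexP; rewrite ?ReD ?ImD !(ReM, ImM) /=.
  under [X in derive X _ _]eq_fun do rewrite ReM.
  have [_ ->] := is_deriveB (dM _ _ fr gr) (dM _ _ fi gi); ring.
under [X in derive X _ _]eq_fun do rewrite ImM.
have [_ ->] := is_deriveD (dM _ _ fr gi) (dM _ _ fi gr); ring.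
Qed.

Lemma cderive_cst v c : cderive v (fun=> c) = fun=> 0.
Proof. by apply/funext => x; apply: complexP => /=; exact: derive_cst. Qed.

Lemma cderiveZ v c f : csmooth f ->
  cderive v (fun x => c * f x) = fun x => c * cderive v f x.
Proof.
move=> sf; rewrite cderiveM//; last exact: csmooth_cst.
by apply/funext => x; rewrite cderive_cst mul0r addr0.
Qed.

Lemma cderive_cexpi v theta :
  cderive v (cexpi theta) = fun x => (0 +i* dotv theta v)%C * cexpi theta x.
Proof.
apply/funext => x; apply: complexP; rewrite ?ReM ?ImM /=.
  have [_ ->] := is_derive_dotv v (is_derive_cos (dotv theta x)); ring.
have [_ ->] := is_derive_dotv v (is_derive_sin (dotv theta x)); ring.
Qed.

Lemma conjcM (z w : C) : conjc (z * w) = conjc z * conjc w.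
Proof. exact: rmorphM. Qed.

Lemma conjc_cexpi theta x : conjc (cexpi theta x) = cexpi (- theta) x.
Proof. by rewrite /cexpi dotvN cosN sinN. Qed.

Lemma normc_cexpi theta x (z : C) :
  ComplexField.Normc.normc (cexpi theta x * z) = ComplexField.Normc.normc z.
Proof.
rewrite ComplexField.Normc.normcM [X in X * _](_ : _ = 1) ?mul1r//.
by rewrite /ComplexField.Normc.normc /= cos2Dsin2 sqrtr1.
Qed.

End complex_smooth.

(** * Test functions and locally integrable functions *)

Section test_functions.
Context (R : realType) (d : nat).
Local Notation C := R[i].
Local Notation V := 'rV[R]_d.
Local Notation F := (V -> C).
Local Notation mu := (leb R d).
Local Notation Re := (@complex.Re R).
Local Notation Im := (@complex.Im R).
Context (Omega : set V) (oO : open Omega).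
Implicit Types (f g u w : F) (v theta x : V) (phi psi : F).
Local Notation test := (test_fun Omega).

Definition vanishes_off (K : set V) f := forall x, ~ K x -> f x = 0.

Lemma test_funP phi : test phi <-> csmooth phi /\
  exists K, [/\ compact K, K `<=` Omega & vanishes_off K phi].
Proof. by split=> -[/csmoothP sp K]; split. Qed.

Lemma test_csmooth phi : test phi -> csmooth phi.
Proof. by case/test_funP. Qed.

Lemma vanishes_off_cderive v (K : set V) f : closed K -> vanishes_off K f ->
  vanishes_off K (cderive v f).
Proof.
move=> cK fK x nKx.
have nf : \forall y \near x, f y = 0.
  have : nbhs x (~` K).
    by apply: open_nbhs_nbhs; split=> //; exact: closed_openC.
  by apply: filterS => y; exact: fK.
apply: complexP => /=.
  rewrite (@near_eq_derive _ _ _ (fun y => Re (f y)) (cst 0)) ?derive_cst//.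
  by near=> y; rewrite (near nf y).
rewrite (@near_eq_derive _ _ _ (fun y => Im (f y)) (cst 0)) ?derive_cst//.
by near=> y; rewrite (near nf y).
Unshelve. all: by end_near. Qed.

Lemma test_cderive v phi : test phi -> test (cderive v phi).
Proof.
move=> /test_funP[sp [K [cK KO pK]]]; apply/test_funP.
split; first exact: csmooth_cderive.
exists K; split=> //; apply: vanishes_off_cderive pK.
exact: compact_closed (@norm_hausdorff _ _) cK.
Qed.

Lemma test_funM b phi : csmooth b -> test phi -> test (fun x => b x * phi x).
Proof.
move=> sb /test_funP[sp [K [cK KO pK]]]; apply/test_funP.
split; first exact: csmoothM.
by exists K; split=> // x nKx; rewrite pK// mulr0.
Qed.

Lemma test_funD phi psi : test phi -> test psi -> test (fun x => phi x + psi x).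
Proof.
move=> /test_funP[sp [K [cK KO pK]]] /test_funP[sq [L [cL LO qL]]].
apply/test_funP; split; first exact: csmoothD.
exists (K `|` L); split; [exact: compactU|by rewrite subUset|].
by move=> x /not_orP[nK nL]; rewrite pK// qL// addr0.
Qed.

Lemma test_funZ c phi : test phi -> test (fun x => c * phi x).
Proof. by apply: test_funM; exact: csmooth_cst. Qed.

Lemma csmooth_measurable phi (D : set V) : csmooth phi -> cmeasurable D phi.
Proof.
move=> [sr si]; split; apply: measurable_funTS.
  exact: continuous_measurable_lrV (smooth_continuous sr).
exact: continuous_measurable_lrV (smooth_continuous si).
Qed.

Lemma cintegrableM_bounded (D : set V) (b w : F) (M : R) :
  measurable (D : set (lrV R d)) -> cmeasurable D b ->
  (forall x, D x -> `|Re (b x)| <= M /\ `|Im (b x)| <= M) ->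
  cintegrable D w -> cintegrable D (fun x => w x * b x).
Proof.
move=> mD [mbr mbi] bM /cintegrableP[wr wi].
have prod (a h : lrV R d -> R) : measurable_fun (D : set (lrV R d)) a ->
    (forall x, D x -> `|a x| <= M) -> rintegrable mu (D : set (lrV R d)) h ->
    rintegrable mu (D : set (lrV R d)) (fun x => h x * a x).
  move=> ma aM ih.
  have ih' : rintegrable mu (D : set (lrV R d)) (fun x => M * `|h x|).
    by apply: (rintegrableZ mD); exact: (integrable_norm ih).
  apply: (rintegrable_le mD _ _ ih').
    apply: measurable_funM => //; exact: rintegrable_meas ih.
  by move=> x Dx; rewrite normrM mulrC ler_wpM2r// aM.
apply/cintegrableP; split.
  under [X in rintegrable _ _ X]eq_fun do rewrite ReM.
  apply: (rintegrableB mD); apply: prod => // x Dx; by have [] := bM _ Dx.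
under [X in rintegrable _ _ X]eq_fun do rewrite ImM.
apply: (rintegrableD mD); apply: prod => // x Dx; by have [] := bM _ Dx.
Qed.

Lemma cintegrable_supp (K D : set V) f : measurable (K : set (lrV R d)) ->
  measurable (D : set (lrV R d)) -> K `<=` D -> vanishes_off K f ->
  cintegrable K f -> cintegrable D f.
Proof.
move=> mK mD KD fK.
have supp (h : lrV R d -> R) : (forall x, ~ K x -> h x = 0) ->
    rintegrable mu (K : set (lrV R d)) h ->
    rintegrable mu (D : set (lrV R d)) h.
  move=> hK /(integrable_mkcond _ mK) iK; apply/(integrable_mkcond _ mD).
  rewrite (_ : _ \_ D = (EFin \o h) \_ K)//; apply/funext => x.
  rewrite !patchE; have [xK|] := boolP (x \in K).
    by rewrite mem_set//; apply: KD; rewrite inE in xK.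
  by rewrite notin_setE => /hK /= ->; case: ifPn.
move=> /cintegrableP[fr fi]; apply/cintegrableP.
by split; apply: supp => // x /fK ->.
Qed.

(** The product is supported in a compact subset of [Omega], where the test
    function is bounded. *)
Lemma L1loc_test w phi : L1loc Omega w -> test phi ->
  cintegrable Omega (fun x => w x * conjc (phi x)).
Proof.
move=> Lw /test_funP[sp [K [cK KO pK]]].
have mK := compact_measurable_lrV cK.
apply: (@cintegrable_supp K) => //; first exact: open_measurable_lrV.
  by move=> x nK; rewrite pK// conjc0 mulr0.
have [sr si] := sp.
have [M1 [_ M1P]] := compact_bounded (continuous_compact
  (continuous_subspaceT (smooth_continuous sr)) cK).
have [M2 [_ M2P]] := compact_bounded (continuous_compact
  (continuous_subspaceT (smooth_continuous si)) cK).
pose M := Num.max (M1 + 1) (M2 + 1).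
apply: (@cintegrableM_bounded _ _ _ M) => //; last exact: Lw.
  have [mr mi] := csmooth_measurable K sp; split.
    by under eq_fun do rewrite ReJ.
  by under eq_fun do rewrite ImJ; exact: measurable_funN.
move=> x Kx; rewrite ReJ ImJ normrN !le_max; split.
  by apply/orP; left; apply: M1P; [rewrite ltrDl|exists x].
by apply/orP; right; apply: M2P; [rewrite ltrDl|exists x].
Qed.

Lemma L1loc_lin c w1 w2 : L1loc Omega w1 -> L1loc Omega w2 ->
  L1loc Omega (fun x => c * w1 x + w2 x).
Proof.
move=> L1 L2 K cK KO; have mK := compact_measurable_lrV cK.
apply: (cintegrableD mK); last exact: L2.
by apply: (cintegrableZ mK); exact: L1.
Qed.

Lemma modulate_cintegrable (D : set V) theta w :
  measurable (D : set (lrV R d)) ->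
  cintegrable D w -> cintegrable D (modulate theta w).
Proof.
move=> mD iw; rewrite /modulate; under eq_fun do rewrite mulrC.
apply: (@cintegrableM_bounded _ _ _ 1) => //.
  exact/csmooth_measurable/csmooth_cexpi.
by move=> x _; rewrite /cexpi /= !ler_norml cos_le1 sin_le1 cos_geN1 sin_geN1.
Qed.

Lemma L1loc_modulate theta w : L1loc Omega w -> L1loc Omega (modulate theta w).
Proof.
move=> Lw K cK KO; apply: modulate_cintegrable; last exact: Lw.
exact: compact_measurable_lrV.
Qed.

(** [Omega] is a countable union of compact boxes. *)
Lemma L1loc_measurable w : L1loc Omega w -> cmeasurable Omega w.
Proof.
move=> Lw; have [B [OB BO]] := open_exhaustion oO.
have iB k : cintegrable (box (B k)) w by apply: Lw => //; exact: compact_box.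
have mB k : measurable (box (B k) : set (lrV R d)) by exact: measurable_box.
rewrite OB; split; apply/(measurable_fun_bigcup _ mB) => k.
  by have [] := cintegrable_cmeasurable (iB k).
by have [] := cintegrable_cmeasurable (iB k).
Qed.

Lemma inner_test_lin c w1 w2 phi :
  L1loc Omega w1 -> L1loc Omega w2 -> test phi ->
  inner Omega (fun x => c * w1 x + w2 x) phi =
  c * inner Omega w1 phi + inner Omega w2 phi.
Proof.
move=> L1 L2 tp; have mO := open_measurable_lrV oO.
rewrite /inner -(cintegralZ mO c (L1loc_test L1 tp)) -(cintegralD mO).
- by congr cintegral; apply/funext => x; rewrite mulrDl mulrA.
- exact: (cintegrableZ mO c (L1loc_test L1 tp)).
- exact: L1loc_test L2 tp.
Qed.

Lemma inner_testZ c w phi : L1loc Omega w -> test phi ->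
  inner Omega (fun x => c * w x) phi = c * inner Omega w phi.
Proof.
move=> L1 tp; have mO := open_measurable_lrV oO.
rewrite /inner -(cintegralZ mO c (L1loc_test L1 tp)).
by congr cintegral; apply/funext => x; rewrite mulrA.
Qed.

Lemma inner_lin_test c w phi psi : L1loc Omega w -> test phi -> test psi ->
  inner Omega w (fun x => c * phi x + psi x) =
  conjc c * inner Omega w phi + inner Omega w psi.
Proof.
move=> L1 tp tq; have mO := open_measurable_lrV oO.
rewrite /inner -(cintegralZ mO (conjc c) (L1loc_test L1 tp)) -(cintegralD mO).
- congr cintegral; apply/funext => x.
  by rewrite rmorphD rmorphM /= mulrDr mulrCA.
- exact: (cintegrableZ mO _ (L1loc_test L1 tp)).
- exact: L1loc_test L1 tq.
Qed.

Lemma inner_modulate theta w phi :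
  inner Omega (modulate theta w) phi = inner Omega w (modulate (- theta) phi).
Proof.
congr cintegral; apply/funext => x; rewrite /modulate conjcM conjc_cexpi.
by rewrite opprK mulrCA mulrA.
Qed.

End test_functions.

(** * Multiplication by plane waves preserves Sobolev spaces *)

Section twisted_derivatives.
Context (R : realType) (d : nat).
Local Notation C := R[i].
Local Notation V := 'rV[R]_d.
Local Notation F := (V -> C).
Implicit Types (f g u w : F) (v theta x : V) (phi psi : F) (s t : seq V).

(** Words of directions, rather than multi-indices, treat mixed partial
    derivatives and iterated normal derivatives alike. With [theta = 0] the
    factors are plain directional derivatives. *)
Definition dword theta s f : F :=
  foldr (fun v g x => cderive v g x + (0 +i* dotv theta v)%C * g x) f s.

Lemma dword_cat theta s t f :
  dword theta (s ++ t) f = dword theta s (dword theta t f).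
Proof. exact: foldr_cat. Qed.

Lemma dword_cons0 v s f : dword 0 (v :: s) f = cderive v (dword 0 s f).
Proof.
apply/funext => x /=; rewrite [dotv 0 v](_ : _ = 0) ?mul0r ?addr0//.
by rewrite /dotv big1// => j _; rewrite mxE mul0r.
Qed.

Lemma csmooth_dword theta s f : csmooth f -> csmooth (dword theta s f).
Proof.
move=> sf; elim: s => //= v s ih; apply: csmoothD; first exact: csmooth_cderive.
by apply: csmoothM ih; exact: csmooth_cst.
Qed.

Lemma dword0_lin s c f g : csmooth f -> csmooth g ->
  dword 0 s (fun x => c * f x + g x) =
    fun x => c * dword 0 s f x + dword 0 s g x.
Proof.
move=> sf sg; elim: s => // v s ih; rewrite !dword_cons0 ih.
have scf : csmooth (fun x => c * dword 0 s f x).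
  by apply: csmoothM; [exact: csmooth_cst|exact: csmooth_dword].
rewrite cderiveD//; last exact: csmooth_dword.
by rewrite cderiveZ//; exact: csmooth_dword.
Qed.

(** Conjugation by the plane wave: a derivative falling on [exp(-i theta x)]
    cancels the twist. *)
Lemma dword_modulate theta s f : csmooth f ->
  dword theta s (modulate (- theta) f) = modulate (- theta) (dword 0 s f).
Proof.
move=> sf; elim: s => // v s ih; rewrite dword_cons0.
rewrite [LHS]/= -/(dword _ _ _) ih; apply/funext => x.
rewrite /modulate cderiveM; [|exact: csmooth_cexpi|exact: csmooth_dword].
rewrite cderive_cexpi dotvN.
have -> : (0 +i* - dotv theta v)%C = - (0 +i* dotv theta v)%C.
  by apply: complexP => /=; rewrite ?oppr0.
by ring.
Qed.

End twisted_derivatives.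

Section modulation.
Context (R : realType) (d : nat).
Local Notation C := R[i].
Local Notation V := 'rV[R]_d.
Local Notation F := (V -> C).
Context (Omega : set V) (oO : open Omega).
Implicit Types (f g u w : F) (v theta x : V) (phi psi : F) (s t : seq V).
Local Notation test := (test_fun Omega).

Lemma test_dword theta s phi : test phi -> test (dword theta s phi).
Proof.
move=> tp; elim: s => //= v s ih; apply: test_funD; first exact: test_cderive.
exact: test_funZ.
Qed.

(** [cl] stands for the regularity to be preserved, square integrability or
    a vanishing trace. *)
Section closed_class.
Context (cl : F -> Prop).
Context (cl_lin : forall c w1 w2, L1loc Omega w1 -> L1loc Omega w2 ->
  cl w1 -> cl w2 -> cl (fun x => c * w1 x + w2 x)).
Context (cl_mod : forall theta w,
  L1loc Omega w -> cl w -> cl (modulate theta w)).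
Context (u : F) (Lu : L1loc Omega u).

Definition represents (Q : F -> F) w :=
  L1loc Omega w /\
  forall phi, test phi -> inner Omega w phi = inner Omega u (Q phi).

(** The first word collects the plain derivatives split off so far;
    expanding the next twisted factor sends one term into it and drops a
    letter from the other. *)
Lemma dword_expansion theta t s :
  (forall r, subseq r t -> exists2 w, cl w & represents (dword 0 (s ++ r)) w) ->
  exists2 w, cl w & represents (fun phi => dword 0 s (dword theta t phi)) w.
Proof.
elim: t s => [|v t ih] s rep.
  by have := rep [::] isT; rewrite cats0.
have [r rt|w1 cw1 [Lw1 r1]] := ih (rcons s v).
  rewrite cat_rcons; apply: rep => /=; by rewrite eqxx.
have [r rt|w0 cw0 [Lw0 r0]] := ih s.
  by apply: rep; exact: subseq_trans rt (subseq_cons _ _).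
pose c : C := (0 +i* dotv theta v)%C.
exists (fun x => conjc c * w0 x + w1 x); first exact: cl_lin.
split; first exact: L1loc_lin.
move=> phi tp; have sp := test_csmooth tp.
rewrite (inner_test_lin oO)// r0// r1//.
rewrite -(inner_lin_test oO)//; last 2 first.
- by do 2!apply: test_dword.
- by do 2!apply: test_dword.
congr inner; rewrite -cats1 dword_cat dword_cons0 [dword 0 [::] _]/=.
have st := csmooth_dword theta t sp.
rewrite -dword0_lin//; last exact: csmooth_cderive.
by congr dword; apply/funext => x /=; rewrite addrC.
Qed.

(** The plane wave moves to the test function, where it twists the
    derivatives; after expansion only plain derivatives along subwords fall
    on test functions, and these move back to [u]. *)
Lemma weakly_modulate theta s :
  (forall r, subseq r s ->
     exists2 w, cl w & weakly Omega (dword 0 r) (size r) u w) ->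
  exists2 w, cl w & weakly Omega (dword 0 s) (size s) (modulate theta u) w.
Proof.
move=> wk.
(* [c w] as the combination [(c - 1) w + w]. *)
have cl_scale c w : L1loc Omega w -> cl w ->
    L1loc Omega (fun x => c * w x) /\ cl (fun x => c * w x).
  move=> Lw cw; have := cl_lin (c - 1) Lw Lw cw cw.
  have := L1loc_lin (c - 1) Lw Lw.
  by under eq_fun do rewrite mulrBl mul1r subrK.
have [r rs|w cw [Lw rw]] := @dword_expansion theta s [::].
  have [w cw [_ Lw rw]] := wk _ rs.
  have [Lw' cw'] := cl_scale ((-1) ^+ size r) _ Lw cw.
  exists (fun x => (-1) ^+ size r * w x); first exact: cw'.
  split=> // phi tp; rewrite (inner_testZ oO)// rw// mulrA -expr2.
  by rewrite sqrr_sign mul1r.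
have [Lw' cw'] := cl_scale ((-1) ^+ size s) _ Lw cw.
exists (modulate theta (fun x => (-1) ^+ size s * w x)); first exact: cl_mod.
split; [exact: L1loc_modulate|exact: L1loc_modulate|move=> phi tp].
have tm : test (modulate (- theta) phi).
  by apply: test_funM tp; exact: csmooth_cexpi.
rewrite !inner_modulate (inner_testZ oO)// rw//; congr (_ * inner _ _ _).
by rewrite [LHS]/= dword_modulate//; exact: test_csmooth tp.
Qed.

End closed_class.

Lemma iter_cderive v j f : iter j (cderive v) f = dword 0 (nseq j v) f.
Proof. by elim: j => // j ih; rewrite iterS ih -dword_cons0. Qed.

Definition directions (a : 'I_d -> nat) (l : seq 'I_d) : seq V :=
  flatten [seq nseq (a j) (unitv R j) | j <- l].

Lemma dtheta_dword theta a f :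
  dtheta theta a f = dword theta (directions a (enum 'I_d)) f.
Proof.
rewrite /dtheta /directions; elim: (enum _) => //= j l ih.
rewrite dword_cat -ih; elim: (a j) => //= k ->.
by apply/funext => x; rewrite dotv_unitv.
Qed.

Lemma size_directions a : size (directions a (enum 'I_d)) = mdeg a.
Proof.
rewrite /mdeg /directions size_flatten /shape -map_comp sumnE big_map.
rewrite big_enum /=.
by apply: eq_bigr => j _; rewrite size_nseq.
Qed.

Lemma subseq_nseq (T : eqType) (r : seq T) n (x : T) :
  subseq r (nseq n x) -> exists2 k, (k <= n)%N & r = nseq k x.
Proof.
move=> rn; exists (size r); first by rewrite -(size_nseq n x) size_subseq.
apply/all_pred1P/allP => y /(mem_subseq rn) /nseqP[-> _]; exact: eqxx.
Qed.

Lemma subseq_directions a l r : uniq l -> subseq r (directions a l) ->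
  exists2 b, (forall j, (b j <= a j)%N) & r = directions b l.
Proof.
elim: l r => [|j l ih] r /=.
  by case: r => // _ _; exists (fun=> 0%N).
move=> /andP[jl ul] /subseqP[m]; rewrite /directions/= -/(directions _ _).
rewrite size_cat => sm ->.
set n := size (nseq (a j) (unitv R j)).
rewrite -(cat_take_drop n m) mask_cat; last first.
  by rewrite size_takel// sm leq_addr.
have [k ka ->] := subseq_nseq (mask_subseq (take n m) (nseq (a j) (unitv R j))).
have [b ba ->] := ih _ ul (mask_subseq (drop n m) (directions a l)).
exists (fun i => if i == j then k else b i).
  by move=> i; case: eqP => [->|].
rewrite eqxx; congr (_ ++ flatten _); apply/eq_in_map => i il.
by case: eqP => // ij; move: jl; rewrite -ij il.
Qed.

Lemma L2space_modulate (D : set V) theta u : measurable (D : set (lrV R d)) ->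
  L2space D u -> L2space D (modulate theta u).
Proof.
move=> mD /(L2spaceP mD)[ur ui]; apply/(L2spaceP mD).
have mc : measurable_fun (D : set (lrV R d)) (fun x => cos (dotv theta x)).
  by have [] := csmooth_measurable D (csmooth_cexpi theta).
have ms : measurable_fun (D : set (lrV R d)) (fun x => sin (dotv theta x)).
  by have [] := csmooth_measurable D (csmooth_cexpi theta).
have c1 x : D x -> `|cos (dotv theta x)| <= 1.
  by move=> _; rewrite ler_norml cos_le1 cos_geN1.
have s1 x : D x -> `|sin (dotv theta x)| <= 1.
  by move=> _; rewrite ler_norml sin_le1 sin_geN1.
split.
  under [X in sqint _ _ X]eq_fun do rewrite ReM.
  exact: (sqintB mD (sqint_bounded mD mc c1 ur) (sqint_bounded mD ms s1 ui)).
under [X in sqint _ _ X]eq_fun do rewrite ImM.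
exact: (sqintD mD (sqint_bounded mD mc c1 ui) (sqint_bounded mD ms s1 ur)).
Qed.

Lemma Wk2_modulate k theta u : Wk2 k Omega u -> Wk2 k Omega (modulate theta u).
Proof.
move=> [L2u wu]; have mO := open_measurable_lrV oO.
split; first exact: L2space_modulate.
move=> a ak.
have wE b w : weak_dtheta Omega 0 b u w <-> weakly Omega
    (dword 0 (directions b (enum 'I_d))) (size (directions b (enum 'I_d))) u w.
  rewrite /weak_dtheta size_directions.
  rewrite (_ : dtheta 0 b = dword 0 (directions b (enum 'I_d)))//.
  by apply/funext => f; exact: dtheta_dword.
have Lu : L1loc Omega u.
  have [|w _ []//] := wu (fun=> 0%N).
  by rewrite /mdeg big1.
have [||r ra|w L2w ww] := @weakly_modulate (L2space Omega) _ _ u Lu theta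
    (directions a (enum 'I_d)).
- by move=> c w1 w2 _ _ L1 L2; apply: (L2spaceD mO) => //; exact: L2spaceZ.
- by move=> th w _; exact: L2space_modulate.
- have [b ba ->] := subseq_directions (enum_uniq _) ra.
  have [|w L2w] := wu b.
    by apply: leq_trans ak; apply: leq_sum => j _; exact: ba.
  by move=> /wE ww; exists w.
exists w => //; move: ww; rewrite size_directions /weak_dtheta.
rewrite (_ : dtheta 0 a = dword 0 (directions a (enum 'I_d)))//.
by apply/funext => f; exact: dtheta_dword.
Qed.

Lemma has_trace_modulate theta w x :
  has_trace Omega w x 0 -> has_trace Omega (modulate theta w) x 0.
Proof.
move=> tw eps e0; have := tw eps e0; apply: filterS => r; apply: le_trans.
rewrite le_eqVlt; apply/orP; left; apply/eqP; apply: eq_integral => y _.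
by rewrite !subr0 normc_cexpi.
Qed.

Lemma normc_measurable (D : set V) w : measurable (D : set (lrV R d)) ->
  cmeasurable D w -> measurable_fun (D : set (lrV R d))
    (fun y => (ComplexField.Normc.normc (w y))%:E).
Proof.
move=> mD [mr mi]; apply/measurable_EFinP.
rewrite (_ : (fun _ => _) =
  Num.sqrt \o (fun y => complex.Re (w y) ^+ 2 + complex.Im (w y) ^+ 2)).
  apply: measurableT_comp.
    exact: (continuous_measurable_fun (@sqrt_continuous R)).
  by apply: measurable_funD; apply: measurable_funX.
apply/funext => y /=; rewrite -normc_sqr sqrtr_sqr ger0_norm//.
by case: (w y) => a b; exact: sqrtr_ge0.
Qed.

(** The averages satisfy the triangle inequality; [eps] is shared out
    between the two terms. *)
Lemma has_trace_lin c w1 w2 x : L1loc Omega w1 -> L1loc Omega w2 ->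
  has_trace Omega w1 x 0 -> has_trace Omega w2 x 0 ->
  has_trace Omega (fun y => c * w1 y + w2 y) x 0.
Proof.
move=> L1 L2 t1 t2 eps e0.
pose N := ComplexField.Normc.normc (R := R); have N0 z : 0 <= N z.
  by case: z => a b; exact: sqrtr_ge0.
have Nc : 0 < N c + 1 by rewrite ltr_wpDl.
have e1 : 0 < eps / 2 / (N c + 1) by rewrite !divr_gt0.
have e2 : 0 < eps / 2 by rewrite divr_gt0.
have := t1 _ e1; have := t2 _ e2; apply: filterS2 => r T2 T1.
set B := ball x r `&` Omega.
have mB : measurable (B : set (lrV R d)).
  by apply: open_measurable_lrV; apply: openI => //; exact: ball_open.
have mO := open_measurable_lrV oO.
have sub (w : F) : L1loc Omega w -> measurable_fun (B : set (lrV R d))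
    (fun y => (N (w y - 0))%:E).
  move=> Lw; under eq_fun do rewrite subr0.
  apply: normc_measurable => //; have [mr mi] := L1loc_measurable oO Lw.
  by split; [apply: measurable_funS mr|apply: measurable_funS mi] => // y [].
have mu0 : (0 <= leb R d B)%E by exact: measure_ge0.
apply: (@le_trans _ _ ((N c)%:E * \int[leb R d]_(y in (B : set (lrV R d)))
    (N (w1 y - 0))%:E + \int[leb R d]_(y in (B : set (lrV R d)))
    (N (w2 y - 0))%:E)%E).
  rewrite -(@ge0_integralZl _ _ _ (leb R d) B mB _ (sub _ L1)); last 2 first.
  - by move=> y _; rewrite lee_fin.
  - by rewrite lee_fin.
  rewrite -(@ge0_integralD _ _ _ (leb R d) B mB); last 4 first.
  - by move=> y _; rewrite -EFinM lee_fin mulr_ge0.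
  - exact: (measurable_funeM _ (sub _ L1)).
  - by move=> y _; rewrite lee_fin.
  - exact: sub L2.
  refine (@ge0_le_integral _ _ _ (leb R d) B mB _ _ _ _ _ _).
  - by move=> y _; rewrite lee_fin.
  - exact: (sub _ (L1loc_lin c L1 L2)).
  - apply: emeasurable_funD; last exact: sub L2.
    exact: (measurable_funeM _ (sub _ L1)).
  - move=> y _; rewrite -EFinM -EFinD lee_fin !subr0 -ComplexField.Normc.normcM.
    exact: normc_triangle.
apply: (@le_trans _ _ ((N c)%:E * ((eps / 2 / (N c + 1))%:E * leb R d B) +
    (eps / 2)%:E * leb R d B)%E).
  by apply: leeD => //; apply: lee_wpmul2l => //; rewrite lee_fin.
have e1c : 0 <= N c * (eps / 2 / (N c + 1)) by rewrite mulr_ge0 ?(ltW e1).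
rewrite muleA -EFinM -ge0_muleDl; [|by rewrite lee_fin|by rewrite lee_fin ltW].
rewrite -EFinD; apply: lee_wpmul2r => //; rewrite lee_fin.
rewrite [leRHS](_ : _ = eps / 2 + eps / 2); last by rewrite -splitr.
rewrite lerD2r mulrCA ler_piMr// ?(ltW e2)//.
by rewrite ler_pdivrMr// mul1r lerDl.
Qed.

Lemma dirichlet_modulate m (Pi : set V) theta u : L1loc Omega u ->
  dirichlet m Pi Omega u -> dirichlet m Pi Omega (modulate theta u).
Proof.
move=> Lu [N N0 hN]; exists N => // x bx Nx.
have [nu nux hnu] := hN x bx Nx; exists nu => // j jm.
have E i : iter i (cderive nu) = dword 0 (nseq i nu).
  by apply/funext => f; exact: iter_cderive.
have [||r rj|w tw ww] := @weakly_modulate (fun w => has_trace Omega w x 0) _ _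
    u Lu theta (nseq j nu).
- by move=> c w1 w2; exact: has_trace_lin.
- by move=> th w _; exact: has_trace_modulate.
- have [k kj ->] := subseq_nseq rj; rewrite size_nseq -E.
  have [w ww tw] := hnu k (leq_ltn_trans kj jm).
  by exists w.
by exists w => //; move: ww; rewrite size_nseq -E.
Qed.

Theorem W_dirichlet_modulate m (Pi : set V) theta u :
  W_dirichlet m Pi Omega u -> W_dirichlet m Pi Omega (modulate theta u).
Proof.
move=> [Wu du]; split; first exact: Wk2_modulate.
apply: dirichlet_modulate du; have [_ wu] := Wu.
by have [|w _ []//] := wu (fun=> 0%N); rewrite /mdeg big1.
Qed.

End modulation.

(** * The spectral gap inequality in L2 *)

Section L2_vectors.
Context (R : realType) (d : nat) (D : set 'rV[R]_d).
Local Notation V := 'rV[R]_d.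
Local Notation F := (V -> Rcomplex R).

Definition L2pred (mD : measurable (D : set (lrV R d))) : pred F :=
  fun f => `[< L2space D f >].

Lemma scale_realE (a : R) (f : F) : a *: f = fun x => a%:C%C * f x.
Proof.
apply/funext => x; apply: complexP; rewrite ?ReM ?ImM /= ?mul0r ?subr0 ?addr0;
  by rewrite fctE; case: (f x).
Qed.

Lemma L2space0 : measurable (D : set (lrV R d)) -> L2space D (fun=> 0).
Proof.
move=> mD; split.
  by split; exact: measurable_cst.
under eq_integral do rewrite ComplexField.Normc.normc0 expr0n.
by rewrite integral0 ltry.
Qed.

Lemma L2pred_submod mD : GRing.subsemimod_closed (L2pred mD).
Proof.
split; [split|].
- apply/asboolP; exact: L2space0.
- by move=> f g /asboolP Lf /asboolP Lg; apply/asboolP; exact: (L2spaceD mD).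
- move=> a f /asboolP Lf; apply/asboolP; rewrite scale_realE.
  exact: (L2spaceZ mD).
Qed.

HB.instance Definition _ mD :=
  GRing.isSubmodClosed.Build R F (L2pred mD) (L2pred_submod mD).

(** Square integrable functions, not identified almost everywhere, as a real
    vector space with a semi-definite form. Real scalars suffice, as only
    real points of the resolvent set are used. *)
Definition L2vec mD := {f : F | L2pred mD f}.
HB.instance Definition _ mD := SubChoice.on (L2vec mD).
HB.instance Definition _ mD := [SubChoice_isSubLmodule of L2vec mD by <:].

Definition L2ip mD (u v : L2vec mD) : R :=
  complex.Re (inner D (\val u) (\val v)).

#[local] Opaque L2space inner.

Context (mD : measurable (D : set (lrV R d))).
Local Notation H := (L2vec mD).
Local Notation ip := (@L2ip mD).

Lemma L2vecP (u : H) : L2space D (\val u).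
Proof. exact/asboolP/(valP u). Qed.

Definition L2vec_of (f : V -> R[i]) (Lf : L2space D f) : H :=
  Sub (f : F) (asboolT Lf : L2pred mD f).

Lemma valL2D (u v : H) : \val (u + v) = fun x => \val u x + \val v x.
Proof. by []. Qed.

Lemma valL2Z a (u : H) : \val (a *: u) = fun x => a%:C%C * \val u x.
Proof. by rewrite -scale_realE. Qed.

Lemma L2ipC u v : ip u v = ip v u.
Proof. by rewrite /L2ip (inner_conj mD (L2vecP v) (L2vecP u)) ReJ. Qed.

Lemma L2ipDl u v w : ip (u + v) w = ip u w + ip v w.
Proof.
by rewrite /L2ip valL2D (innerDl mD (L2vecP u) (L2vecP v) (L2vecP w)) ReD.
Qed.

Lemma L2ipZl a u v : ip (a *: u) v = a * ip u v.
Proof.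
rewrite /L2ip valL2Z (innerZl mD _ (L2vecP u) (L2vecP v)).
by rewrite ReM mul0r subr0.
Qed.

Lemma L2ip_ge0 u : 0 <= ip u u.
Proof. exact: (Re_inner_ge0 mD (L2vecP u)). Qed.

Lemma L2ip_complete (x : nat -> H) C :
  (forall k, ip (x k - x k.+1) (x k - x k.+1) <= C * 16%:R ^- k) ->
  exists v, (fun k => ip (x k - v) (x k - v)) @ \oo --> 0.
Proof.
move=> xC; have [g Lg xg] := L2space_complete mD (fun k => L2vecP (x k)) xC.
by exists (L2vec_of Lg).
Qed.

Section operator.
Context (dom : set (V -> R[i])) (T : (V -> R[i]) -> (V -> R[i])).
Context (sa : self_adjoint D dom T).

Let domL2 u : dom u -> L2space D u.
Proof. by case: sa => s _ _ /s[]. Qed.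

Let TL2 u : dom u -> L2space D (T u).
Proof. by case: sa => s _ _ /s[]. Qed.

Let sym u v : dom u -> dom v -> inner D (T u) v = inner D u (T v).
Proof.
move=> du dv; have [_ _ /(_ v (T v) (domL2 dv) (TL2 dv))[h _]] := sa.
by apply: h => //; split=> //; exact: aeW.
Qed.

(** Linearity of the operator follows from self-adjointness. *)
Lemma self_adjoint_scale c u : dom u ->
  dom (fun x => c * u x) /\ eq_ae D (T (fun x => c * u x)) (fun x => c * T u x).
Proof.
move=> du; have [Lu LT] := (domL2 du, TL2 du).
have [_ _ /(_ _ _ (L2spaceZ mD c Lu) (L2spaceZ mD c LT))[_ h]] := sa.
apply: h => w dw.
rewrite (innerZr mD c Lu (TL2 dw)) (innerZr mD c LT (domL2 dw)).
by rewrite (sym dw du).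
Qed.

Definition shifted_graph (L : R) (v g : H) : Prop :=
  dom (\val v) /\ eq_ae D (T (\val v)) (fun x => \val g x + L%:C%C * \val v x).

(** Self-adjointness for the real part of the inner product: the imaginary
    part is recovered by testing with [i u]. *)
Lemma shifted_graph_selfadjoint L v g : shifted_graph L v g <->
  forall u f, shifted_graph L u f -> ip f v = ip u g.
Proof.
have LZ (w : H) : L2space D (fun x => L%:C%C * \val w x).
  exact: (L2spaceZ mD _ (L2vecP w)).
have LDZ (f w : H) : L2space D (fun x => \val f x + L%:C%C * \val w x).
  exact: (L2spaceD mD (L2vecP f) (LZ w)).
have [_ _ /(_ _ _ (L2vecP v) (LDZ g v)) sav] := sa.
split=> [/sav h u f [du Tu]|h].
  have := h _ du.
  rewrite (inner_ael mD (TL2 du) (LDZ f u) (L2vecP v) Tu).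
  rewrite (innerDl mD (L2vecP f) (LZ u) (L2vecP v)).
  rewrite (innerDr mD (L2vecP g) (LZ v) (L2vecP u)).
  rewrite (innerZl mD _ (L2vecP u) (L2vecP v)).
  rewrite (innerZr mD _ (L2vecP v) (L2vecP u)).
  by rewrite /L2ip conjc_real => /addIr ->.
apply/sav.
have key u : dom u -> complex.Re (inner D (T u) (\val v)) =
    complex.Re (inner D u (fun x => \val g x + L%:C%C * \val v x)).
  move=> du; have [Lu LT] := (domL2 du, TL2 du).
  have Lf := L2spaceB mD LT (L2spaceZ mD L%:C%C Lu).
  have Gu : shifted_graph L (L2vec_of Lu) (L2vec_of Lf).
    by split=> //; apply: aeW => x _ /=; rewrite subrK.
  have := h _ _ Gu; rewrite /L2ip /= => E.
  rewrite (innerDr mD (L2vecP g) (LZ v) Lu) (innerZr mD _ (L2vecP v) Lu) ReD -E.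
  rewrite conjc_real -(innerZl mD _ Lu (L2vecP v)) -ReD.
  rewrite -(innerDl mD Lf (L2spaceZ mD L%:C%C Lu) (L2vecP v)).
  by congr (complex.Re (inner _ _ _)); apply/funext => x; rewrite subrK.
move=> u du; apply: complexP; first exact: key.
have [di Ti] := self_adjoint_scale (0 +i* 1)%C du.
have := key _ di.
rewrite (inner_ael mD (TL2 di) (L2spaceZ mD _ (TL2 du)) (L2vecP v) Ti).
rewrite (innerZl mD _ (TL2 du) (L2vecP v)) (innerZl mD _ (domL2 du) (LDZ g v)).
by rewrite !ReM /= !mul0r !mul1r !sub0r => /oppr_inj.
Qed.

(** The bound on all solutions comes from uniqueness. *)
Lemma resolvent_at_shifted L s : in_resolvent D dom T (L + s)%:C%C ->
  resolvent_at ip (shifted_graph L) s.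
Proof.
move=> [M res]; exists (M ^+ 2); split=> [f|u f [du Tu]].
  have [u [du Tu _ _]] := res _ (L2vecP f).
  exists (L2vec_of (domL2 du)); split=> //.
  apply: filterS Tu => x Tu Dx; have := Tu Dx.
  rewrite valL2D valL2Z /= => <-.
  by rewrite rmorphD /= mulrDl opprD addrA; ring.
have [u' [du' Tu' uM uni]] := res _ (L2vecP f).
have uu' : eq_ae D (\val u) u'.
  apply: uni => //; apply: filterS Tu => x Tu Dx; rewrite (Tu Dx).
  by rewrite valL2D valL2Z rmorphD /=; ring.
have Lu' := domL2 du'.
have -> : ip u u = L2norm D u' ^+ 2.
  rewrite (L2norm_sqr mD Lu') /L2ip.
  rewrite (inner_ael mD (L2vecP u) Lu' (L2vecP u) uu').
  by rewrite (inner_aer mD (L2vecP u) Lu' Lu' uu').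
rewrite /L2ip -(L2norm_sqr mD (L2vecP f)) -exprMn.
by rewrite lerXn2r ?nnegrE ?sqrtr_ge0//; apply: le_trans uM; exact: sqrtr_ge0.
Qed.

(** [spectral_gap_form] for the graph of [T - L]. *)
Theorem self_adjoint_spectral_gap (L c : R) : 0 < c ->
  (forall s : R, s < L + c -> s != L -> in_resolvent D dom T s%:C%C) ->
  forall u, dom u ->
  (forall k, dom k -> eq_ae D (T k) (fun x => L%:C%C * k x) ->
     inner D u k = 0) ->
  c * complex.Re (inner D u u) <=
    complex.Re (inner D (fun x => T u x - L%:C%C * u x) u).
Proof.
move=> c0 res u du uker.
have Lu := domL2 du; have Lf := L2spaceB mD (TL2 du) (L2spaceZ mD L%:C%C Lu).
apply: (spectral_gap_form L2ipC L2ipDl L2ipZl L2ip_ge0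
  (shifted_graph_selfadjoint L) c0 _ _ L2ip_complete
  (u := L2vec_of Lu) (f := L2vec_of Lf)).
- move=> s s0; apply: resolvent_at_shifted; apply: res; first lra.
  by rewrite -subr_eq0 addrC addKr lt_eqF.
- move=> s /andP[s0 sc]; apply: resolvent_at_shifted; apply: res.
    by rewrite ltrD2l.
  by rewrite -subr_eq0 addrC addKr gt_eqF.
- by split=> //; apply: aeW => x _ /=; rewrite subrK.
- move=> k [dk Tk]; rewrite /L2ip uker//; apply: filterS Tk => x Tk Dx.
  by rewrite (Tk Dx) add0r.
Qed.

End operator.
End L2_vectors.

(** * The sign of the second order coefficient *)

Lemma L2space_sum (R : realType) (d : nat) (D : set 'rV[R]_d) n
    (psi : 'I_n -> 'rV[R]_d -> R[i]) (c : 'I_n -> R[i]) :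
  measurable (D : set (lrV R d)) -> (forall i, L2space D (psi i)) ->
  L2space D (fun x => \sum_i c i * psi i x).
Proof.
move=> mD Lpsi; elim: (index_enum _) => [|i s ih].
  under eq_fun do rewrite big_nil; exact: L2space0.
under eq_fun do rewrite big_cons.
exact: (L2spaceD mD (L2spaceZ mD _ (Lpsi i)) ih).
Qed.

Lemma inner_sum_eq0 (R : realType) (d : nat) (D : set 'rV[R]_d) n
    (psi : 'I_n -> 'rV[R]_d -> R[i]) (c : 'I_n -> R[i]) (u : 'rV[R]_d -> R[i]) :
  measurable (D : set (lrV R d)) -> (forall i, L2space D (psi i)) ->
  L2space D u -> (forall i, inner D u (psi i) = 0) ->
  inner D u (fun x => \sum_i c i * psi i x) = 0.
Proof.
move=> mD Lpsi Lu u0.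
suff : L2space D (fun x => \sum_i c i * psi i x) /\
  inner D u (fun x => \sum_i c i * psi i x) = 0 by case.
elim: (index_enum _) => [|i s [Ls is0]].
  have -> : (fun x => \sum_(i <- [::]) c i * psi i x) = fun x => 0 * u x.
    by apply/funext => x; rewrite big_nil mul0r.
  split; first exact: (L2spaceZ mD).
  by rewrite (innerZr mD _ Lu Lu) conjc0 mul0r.
have -> : (fun x => \sum_(j <- i :: s) c j * psi j x) =
    fun x => c i * psi i x + \sum_(j <- s) c j * psi j x.
  by apply/funext => x; rewrite big_cons.
have Li := L2spaceZ mD (c i) (Lpsi i); split; first exact: (L2spaceD mD).
by rewrite (innerDr mD Li Ls Lu) (innerZr mD _ (Lpsi i) Lu) u0 is0 mulr0 addr0.
Qed.

(** The gap inequality at [psi1] bounds the first term of [Lambda2]; both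
    terms are real, by the symmetry of the fibre operator and by the sign of
    [L2]. *)
Theorem corollary2p4 (R : realType) (d d1 m : nat)
    (hd1 : (0 < d1 <= d)%N) (hm : (0 < m)%N)
    (e es : 'M[R]_(d1, d)) (Pi cell : set 'rV[R]_d)
    (hgeom : geometry m e Pi cell) (hdual : dual_basis e es)
    (c0 : R) (hc0 : 0 < c0)
    (A : {ffun 'I_d -> 'I_m.+1} -> {ffun 'I_d -> 'I_m.+1} ->
         ('rV[R]_d -> R[i]))
    (hA : coefficients e Pi c0 A)
    (t0 : R) (ht0 : 0 < t0)
    (L1 L2 : ('rV[R]_d -> R[i]) -> ('rV[R]_d -> R[i]))
    (L3 L : R -> ('rV[R]_d -> R[i]) -> ('rV[R]_d -> R[i]))
    (hL : perturbation m Pi cell t0 L1 L2 L3 L)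
    (sm sp : R) (hs : sm < 0 < sp \/ 0 <= sm < sp)
    (hself : forall theta, dual_cell es theta ->
       self_adjoint cell (dom_H0 e Pi cell A theta) (H0 cell A theta))
    (hE0 : forall theta, dual_cell es theta ->
       lowest_discrete e Pi cell A theta)
    (theta0 : 'rV[R]_d) (n : nat) (psi0 : 'I_n -> ('rV[R]_d -> R[i]))
    (i0 : 'I_n) (ss Lambda0 : R)
    (hLambda0 : E0 e Pi cell A theta0 = Lambda0%:E)
    (hpsi0 : eigenbasis cell (dom_H0 e Pi cell A theta0) (H0 cell A theta0)
               Lambda0%:C%C psi0)
    (hdiag : forall i j, i != j ->
       melem cell theta0 L1 (psi0 i) (psi0 j) = 0)
    (htriple : minimizing_triple e es Pi cell A L1 sm sp theta0 psi0 i0 ss)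
    (Lambda1 : R[i])
    (hLambda1 : Lambda1 = melem cell theta0 L1 (psi0 i0) (psi0 i0))
    (psi1 : 'rV[R]_d -> R[i])
    (hpsi1_dom : dom_H0 e Pi cell A theta0 psi1)
    (hpsi1_orth : forall j, inner cell psi1 (psi0 j) = 0)
    (hpsi1_eq : eq_ae cell
       (fun x => H0 cell A theta0 psi1 x - Lambda0%:C%C * psi1 x)
       (fun x => - modulate (- theta0) (L1 (modulate theta0 (psi0 i0))) x
                 + Lambda1 * psi0 i0 x))
    (Lambda2 : R[i])
    (hLambda2 : Lambda2 = melem cell theta0 L1 psi1 (psi0 i0)
                          + melem cell theta0 L2 (psi0 i0) (psi0 i0))
    (hLambda1_eq0 : Lambda1 = 0)
    (hL2 : nonpositive_op m Pi cell L2)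
    (c1 : R) (hc1 : 0 < c1)
    (hgap : forall theta, dual_cell es theta ->
       (c1%:E <= spectral_gap e Pi cell A theta)%E) :
  Lambda2 <= - (c1 * L2norm cell psi1 ^+ 2)%:C%C.
Proof.
have oD : open cell by case: hgeom => _ _ _ _ [[]].
have mD := open_measurable_lrV oD.
have dual0 : dual_cell es theta0 by case: htriple.
have sa := hself _ dual0.
set T := H0 cell A theta0 in sa hpsi0 hpsi1_eq.
set dom := dom_H0 e Pi cell A theta0 in sa hpsi0 hpsi1_dom.
have [eig _ basis] := hpsi0.
have domW u : dom u -> W_dirichlet m Pi cell (modulate theta0 u).
  by move=> [Wu _ _]; exact: W_dirichlet_modulate.
have domL2 u : dom u -> L2space cell u by case: sa => s _ _ /s[].
have L2T u : dom u -> L2space cell (T u) by case: sa => s _ _ /s[].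
have d0 i : dom (psi0 i) by case: (eig i).
have L0 i := domL2 _ (d0 i).
have Lpsi1 := domL2 _ hpsi1_dom.
have [[[M1 [L1L2 _ _]] L1sym] _ _ _ _] := hL.
pose f x := T psi1 x - Lambda0%:C%C * psi1 x.
have Lf : L2space cell f := L2spaceB mD (L2T _ hpsi1_dom) (L2spaceZ mD _ Lpsi1).
(* A spectral value is at least the infimum, and off it by at least the gap. *)
have res s : s < Lambda0 + c1 -> s != Lambda0 -> in_resolvent cell dom T s%:C%C.
  move=> sc sL; apply: contrapT => spec.
  have Ls : Lambda0 <= s.
    by rewrite -lee_fin -hLambda0; apply: ereal_inf_lbound; exists s.
  have := hgap _ dual0; rewrite /spectral_gap hLambda0 /= => gap.
  have : (c1%:E <= (ComplexField.Normc.normc (Lambda0%:C - s%:C)%C)%:E)%E.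
    apply: le_trans gap _; apply: ereal_inf_lbound; exists s%:C%C => //.
    by split=> //= -[] /eqP; rewrite (negbTE sL).
  rewrite lee_fin -rmorphB /= expr0n addr0 sqrtr_sqr distrC.
  rewrite ger0_norm ?subr_ge0//.
  by rewrite leNgt ltrBlDl sc.
have gap : c1 * complex.Re (inner cell psi1 psi1) <=
    complex.Re (inner cell f psi1).
  apply: (self_adjoint_spectral_gap mD sa hc1 res hpsi1_dom) => k dk Tk.
  have [c kc] := basis k (conj dk Tk).
  rewrite (inner_aer mD (domL2 _ dk) (L2space_sum c mD L0) Lpsi1 kc).
  exact: inner_sum_eq0.
have W0 := domW _ (d0 i0); have W1 := domW _ hpsi1_dom.
pose g := modulate (- theta0) (L1 (modulate theta0 (psi0 i0))).
have Lg : L2space cell g by apply: L2space_modulate => //; exact: L1L2.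
have gf : eq_ae cell g (fun x => -1 * f x).
  apply: filterS hpsi1_eq => x E Dx; move: (E Dx).
  by rewrite hLambda1_eq0 mul0r addr0 /f => ->; rewrite mulN1r opprK.
have first_term : melem cell theta0 L1 psi1 (psi0 i0) = - inner cell psi1 f.
  rewrite /melem (L1sym _ _ W1 W0) inner_modulate -/g.
  rewrite (inner_aer mD Lg (L2spaceZ mD _ Lf) Lpsi1 gf) (innerZr mD _ Lf Lpsi1).
  by rewrite rmorphN rmorph1 mulN1r.
have f_real : inner cell psi1 f = inner cell f psi1.
  have symT : inner cell (T psi1) psi1 = inner cell psi1 (T psi1).
    have [_ _ /(_ _ _ Lpsi1 (L2T _ hpsi1_dom))[h _]] := sa.
    by apply: h => //; split=> //; exact: aeW.
  have LN := L2spaceZ mD (- Lambda0%:C%C) Lpsi1.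
  have -> : f = fun x => T psi1 x + - Lambda0%:C%C * psi1 x.
    by apply/funext => x; rewrite /f mulNr.
  rewrite (innerDr mD (L2T _ hpsi1_dom) LN Lpsi1).
  rewrite (innerDl mD (L2T _ hpsi1_dom) LN Lpsi1) symT.
  rewrite (innerZr mD _ Lpsi1 Lpsi1) (innerZl mD _ Lpsi1 Lpsi1).
  by rewrite rmorphN /= oppr0.
have im0 : complex.Im (inner cell f psi1) = 0.
  have := inner_conj mD Lf Lpsi1; rewrite f_real => /(congr1 (@complex.Im R)).
  by rewrite ImJ; lra.
have := hL2 _ W0; rewrite -/(melem cell theta0 L2 (psi0 i0) (psi0 i0)).
rewrite hLambda2 first_term f_real; rewrite -(L2norm_sqr mD Lpsi1) in gap.
move: (melem cell theta0 L2 _ _) (inner cell f psi1) (L2norm cell psi1) im0 gap.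
move=> [yr yi] [zr zi] nrm /= -> zc; rewrite !lecE /= => /andP[/eqP <- yr0].
by rewrite !oppr0 addr0 eqxx /=; lra.
Qed.
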